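(* For each integer $m\ge 6.52\times10^9$ there is a prime $p\in(m^2,2m^2)$ for which $m/p$ is not the sum of $3$ unit fractions, i.e. there are no positive integers $x,y,z$ with $\frac mp=\frac1x+\frac1y+\frac1z$.
   Context: A unit fraction is a number $1/x$ with $x$ a positive integer; the summands need not be distinct. *)

(* Defs.v *)
From mathcomp Require Import all_boot all_order all_algebra.

Set Implicit Arguments.
Unset Strict Implicit.
Unset Printing Implicit Defensive.

(* Main.v *)
Require Import Defs.
From Stdlib Require NArith.
From mathcomp Require Import all_boot all_order all_algebra.
From mathcomp Require Import realalg zify ring lra.

(** The primes p in (m^2, 2m^2) for which m/p is a sum of three unit fractions
    are parametrized, and shown to be fewer than the primes in that interval.

    If p divides two of the denominators, then p = m k a (g e - a) - e with
    k a g e <= 4m + 4; Rankin's trick leaves O(m^(7/6)) such primes.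

    If p divides one denominator, then p = m k a h - f with k a h <= 4m and
    f a divisor of N = m k a^2 + 1; for given k, a, f at most 1 + m/(ka) values
    of h put p in the interval.  The number of divisors of N is at most N^(1/6)
    times a product of weights over the primes q <= 61 dividing N.  That product
    can be as large as 140, but its average over an interval of values of a (or
    of k) is below 8.5, since m k a^2 = -1 mod q has at most two roots a and at
    most one root k.  Averaging over the larger of a and k gives at most
    680 m^(3/2) primes of this kind.

    Erdos's analysis of the central binomial coefficient gives about
    (2/3) m^2 / log_2(2 m^2) primes in the interval, which is more as soon as
    m >= 6.52 * 10^9. *)

Set Implicit Arguments.
Unset Strict Implicit.
Unset Printing Implicit Defensive.

Import Order.TTheory GRing.Theory Num.Theory.

(** * Parametrization of the solutions *)

(** The exponent 1/6 shapes the count. A prime [q >= 64] has [q^(1/6) >= 2], so finitely many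
    weights suffice. As [k a <= 4m], the factor [N^(1/6)] has order at most [m^(1/2) k^(-1/6)]; when
    [k] is the smaller variable, summing over both leads to the convergent sum of [k^(-7/6)], so the
    order is [m^(3/2)] without a logarithm. When [a] is the smaller one, the main term only has
    order [m^(17/12)]. The obstacle is that averaging weights over an interval of length [L] gives
    [8.43 L + 2007], and the additive 2007 is paid on every interval. Averaging over the larger
    variable leaves at most [2 m^(1/2)] values of the smaller one, and the additive parts then sum
    to order [m^(7/6)]. The estimates are written as polynomials in [mu = m^(1/6)], and lower powers
    of [mu] are absorbed through [mu >= 43.2]. *)

Lemma unit_fraction_pair (n t y z : nat) :
  0 < n -> 0 < t -> 0 < y -> 0 < z -> coprime n t ->
  n * (y * z) = t * (y + z) ->
  exists k a b h : nat, [/\ [/\ 0 < k, 0 < a & 0 < h], a <= b,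
    t = k * a * b & a + b = n * h].
Proof.
move=> n0 t0 y0 z0 cnt E.
have g0 : 0 < gcdn y z by rewrite gcdn_gt0 y0.
have [a ya] := dvdnP (dvdn_gcdl y z); have [b zb] := dvdnP (dvdn_gcdr y z).
set g := gcdn y z in g0 ya zb.
have cab : coprime a b.
  have : gcdn a b * g = g by rewrite muln_gcdl -ya -zb.
  move=> H; rewrite /coprime -(eqn_pmul2r g0) mul1n; exact/eqP.
have a0 : 0 < a by case: a ya {cab} => // ya; move: y0; rewrite ya.
have b0 : 0 < b by case: b zb {cab} => // zb; move: z0; rewrite zb.
have E1 : n * g * (a * b) = t * (a + b).
  apply/eqP; rewrite -(eqn_pmul2r g0); apply/eqP.
  by move: E; rewrite ya zb; lia.
(* [a * b] is coprime to [a + b], so it divides [t]; the quotient [k] satisfies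
   [n * g = k * (a + b)], and [n], being coprime to [k], divides [a + b]. *)
have : a * b %| t.
  rewrite -(@Gauss_dvdl _ t (a + b)); first by rewrite -E1 dvdn_mull.
  rewrite coprimeMl; apply/andP; split.
    by rewrite /coprime gcdnDl.
  by rewrite /coprime gcdnDr gcdnC.
case/dvdnP=> k tk.
have ab0 : 0 < a * b by rewrite muln_gt0 a0.
have k0 : 0 < k by case: k tk => // tk; move: t0; rewrite tk.
have E2 : n * g = k * (a + b).
  by apply/eqP; rewrite -(eqn_pmul2r ab0) E1 tk; apply/eqP; lia.
have : n %| a + b.
  rewrite -(@Gauss_dvdr n k); first by rewrite -E2 dvdn_mulr.
  by move: cnt; rewrite tk coprimeMr => /andP[].
case/dvdnP=> h abh.
have h0 : 0 < h by case: h abh => //; lia.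
have [leab|ltba] := leqP a b.
  by exists k, a, b, h; split=> //; lia.
by exists k, b, a, h; split=> //; lia.
Qed.

(** Here the denominators are [p t], [y], [z]. Removing [1/(p t)] from [m/p] leaves
    [(m t - 1)/(p t)], so [p] divides [m t - 1 = e p] and [e/t = 1/y + 1/z] is in lowest terms. With
    [t = k a b] and [a + b = e h] one gets [e (m k a h - p) = m k a^2 + 1]: the divisor [f] has
    cofactor [e]. *)
Lemma prime_third_type1 (m p t y z : nat) :
  prime p -> 0 < m -> p < 2 * m ^ 2 -> 0 < t -> 0 < y -> 0 < z ->
  ~~ (p %| y) -> ~~ (p %| z) ->
  m * t * (y * z) = y * z + p * t * (y + z) ->
  exists k a h f : nat, [/\ [/\ 0 < k, 0 < a & 0 < h], f %| m * k * a ^ 2 + 1,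
    p + f = m * k * a * h & k * a * h <= 4 * m].
Proof.
move=> pp m0 pm t0 y0 z0 py pz E.
have mt0 : 0 < m * t by rewrite muln_gt0 m0.
have E1 : (m * t).-1 * (y * z) = p * (t * (y + z)).
  by rewrite -subn1 mulnBl mul1n E; lia.
have : p %| (m * t).-1.
  have : p %| (m * t).-1 * (y * z) by rewrite E1 dvdn_mulr.
  by rewrite !Euclid_dvdM // (negPf py) (negPf pz) !orbF.
case/dvdnP=> e Ee.
have p0 := prime_gt0 pp.
have E2 : e * (y * z) = t * (y + z).
  by apply/eqP; rewrite -(eqn_pmul2l p0) -E1 Ee; apply/eqP; lia.
have e0 : 0 < e.
  case: e E2 {Ee} => // /esym/eqP; rewrite mul0n muln_eq0; lia.
have cet : coprime e t.
  have : coprime (e * p) (m * t).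
    by rewrite -Ee -[X in coprime _ X]prednK // coprimenS.
  by rewrite coprimeMl coprimeMr => /andP[/andP[]].
have [k [a [b [h [[k0 a0 h0] ab tk abh]]]]] := unit_fraction_pair e0 t0 y0 z0 cet E2.
have E3 : m * k * a * b = e * p + 1 by rewrite -Ee addn1 prednK // tk; lia.
have E4 : e * (m * k * a * h) = e * p + (m * k * a ^ 2 + 1).
  have -> : e * (m * k * a * h) = m * k * a * (e * h) by lia.
  by rewrite -abh mulnDr E3; lia.
have lep : p <= m * k * a * h.
  by rewrite -(leq_pmul2l e0) E4 leq_addr.
exists k, a, h, (m * k * a * h - p); split=> //.
- apply/dvdnP; exists e; rewrite mulnBr E4; lia.
- lia.
(* Since [a <= b], [e m k a h = m k a (a + b) <= 2 m k a b = 2 (e p + 1)]; hence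
   [m k a h <= 2 p + 2 <= 4 m^2]. *)
have H : e * (m * k * a * h) <= 2 * (e * p + 1).
  have -> : e * (m * k * a * h) = m * k * a * (e * h) by lia.
  rewrite -abh -E3; nia.
have H2 : m * (k * a * h) <= m * (4 * m) by nia.
by rewrite -(leq_pmul2l m0).
Qed.

(** Here the denominators are [x], [p y], [p z]. With [e = m x - p], the fraction [e/x = 1/y + 1/z]
    is in lowest terms because [p] does not divide [x]; then [x = k a b] and [b = g e - a]. *)
Lemma prime_third_type2 (m p x y z : nat) :
  prime p -> 3 < m -> p < 2 * m ^ 2 -> 0 < x -> 0 < y -> 0 < z ->
  ~~ (p %| x) ->
  m * x * (y * z) = p * (y * z) + x * (y + z) ->
  exists k a g e : nat, [/\ [/\ 0 < k, 0 < a, 0 < g & 0 < e],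
    p + e = m * k * a * (g * e - a) & k * a * g * e <= 4 * m + 4].
Proof.
move=> pp m3 pm x0 y0 z0 px E.
have yz0 : 0 < y * z by rewrite muln_gt0 y0.
have lep : p < m * x.
  rewrite -(ltn_pmul2r yz0) E; nia.
set e := m * x - p; have e0 : 0 < e by rewrite subn_gt0.
have Ee : m * x = p + e by rewrite /e; lia.
have E1 : e * (y * z) = x * (y + z) by move: E; rewrite Ee mulnDl; lia.
have cex : coprime e x.
  have cpx : coprime p x by rewrite prime_coprime.
  rewrite /coprime -dvdn1 -(eqP cpx) dvdn_gcd dvdn_gcdr andbT.
  have : gcdn e x %| p + e by rewrite -Ee dvdn_mull // dvdn_gcdr.
  by rewrite dvdn_addl // dvdn_gcdl.
have [k [a [b [g [[k0 a0 g0] ab xk abg]]]]] := unit_fraction_pair e0 x0 y0 z0 cex E1.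
have E3 : p + e = m * k * a * b by rewrite -Ee xk; lia.
exists k, a, g, e; split=> //.
  by rewrite [g * e]mulnC -abg addKn.
have -> : k * a * g * e = k * a * (e * g) by lia.
rewrite -abg.
have H1 : e <= k * a * b + 1.
  have : e <= a + b by rewrite abg leq_pmulr.
  have : a + b <= a * b + 1 by clear -a0 ab; nia.
  have : a * b <= k * a * b by rewrite -mulnA leq_pmull.
  lia.
have H2 : k * a * (a + b) <= 2 * (k * a * b).
  by rewrite mulnCA leq_mul2l mul2n -addnn leq_add2r ab orbT.
suff : k * a * b <= 2 * m + 2 by lia.
have H3 : m * (k * a * b) <= 2 * m ^ 2 + k * a * b by lia.
move: (k * a * b) H3 => w H3.
(* [(m - 1) w <= 2 m^2] excludes [w >= 2 m + 3], since [(m - 1) (2 m + 3) = 2 m^2 + m - 3] exceeds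
   [2 m^2] for [m > 3]. *)
rewrite leqNgt; apply/negP => /subnKC Ew.
by move: H3; rewrite -Ew; clear -m3; nia.
Qed.

(** The cases count the denominators divisible by [p]. There is at least one, because [p > m^2] does
    not divide [m]; three would make [m] itself a sum of three unit fractions, hence at most 3. *)
Lemma unit_fraction_sum_cases (m p x y z : nat) :
  prime p -> 3 < m -> m ^ 2 < p -> p < 2 * m ^ 2 ->
  0 < x -> 0 < y -> 0 < z ->
  (m%:R / p%:R = x%:R^-1 + y%:R^-1 + z%:R^-1 :> rat)%R ->
  (exists k a h f : nat, [/\ [/\ 0 < k, 0 < a & 0 < h], f %| m * k * a ^ 2 + 1,
    p + f = m * k * a * h & k * a * h <= 4 * m]) \/
  (exists k a g e : nat, [/\ [/\ 0 < k, 0 < a, 0 < g & 0 < e],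
    p + e = m * k * a * (g * e - a) & k * a * g * e <= 4 * m + 4]).
Proof.
move=> pp m3 mp pm x0 y0 z0 E.
have p0 := prime_gt0 pp; have m0 : 0 < m by lia.
have {E} E : m * (x * y * z) = p * (y * z + x * z + x * y).
  apply/eqP; rewrite -(eqr_nat rat) !natrM !natrD !natrM; apply/eqP.
  have nz n : 0 < n -> (n%:R : rat)%R != 0%R by rewrite pnatr_eq0 lt0n.
  have -> : (m%:R : rat)%R = (p%:R * (x%:R^-1 + y%:R^-1 + z%:R^-1))%R.
    by rewrite -E mulrC divfK ?nz.
  by field; rewrite !nz.
have pNm : ~~ (p %| m).
  by apply/negP => /(dvdn_leq m0); nia.
have key1 u v w : 0 < u -> 0 < v -> 0 < w -> p %| u -> ~~ (p %| v) ->
    ~~ (p %| w) -> m * (u * v * w) = p * (v * w + u * w + u * v) ->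
  exists k a h f : nat, [/\ [/\ 0 < k, 0 < a & 0 < h], f %| m * k * a ^ 2 + 1,
    p + f = m * k * a * h & k * a * h <= 4 * m].
  move=> u0 v0 w0 /dvdnP[t ut] pv pw Eq.
  have t0 : 0 < t by case: t ut u0 => // ->.
  apply: (@prime_third_type1 m p t v w) => //.
  apply/eqP; rewrite -(eqn_pmul2l p0); apply/eqP; rewrite ut in Eq; lia.
have key2 u v w : 0 < u -> 0 < v -> 0 < w -> ~~ (p %| u) -> p %| v ->
    p %| w -> m * (u * v * w) = p * (v * w + u * w + u * v) ->
  exists k a g e : nat, [/\ [/\ 0 < k, 0 < a, 0 < g & 0 < e],
    p + e = m * k * a * (g * e - a) & k * a * g * e <= 4 * m + 4].
  move=> u0 v0 w0 pu /dvdnP[t vt] /dvdnP[s ws] Eq.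
  have t0 : 0 < t by case: t vt v0 => // ->.
  have s0 : 0 < s by case: s ws w0 => // ->.
  apply: (@prime_third_type2 m p u t s) => //.
  apply/eqP; rewrite -(eqn_pmul2l p0) -(eqn_pmul2l p0); apply/eqP.
  rewrite vt ws in Eq; lia.
have : p %| m * (x * y * z) by rewrite E dvdn_mulr.
rewrite !Euclid_dvdM // (negPf pNm) /= => H.
have [px|px] := boolP (p %| x); have [py|py] := boolP (p %| y);
  have [pz|pz] := boolP (p %| z); last by move: H; rewrite (negPf px) (negPf py) (negPf pz).
- case/dvdnP: px => t ut; case/dvdnP: py => s vs; case/dvdnP: pz => r wr.
  move: x0 y0 z0 E; rewrite ut vs wr !muln_gt0 p0 !andbT => t0 s0 r0 E.
  have E' : m * (t * s * r) = s * r + t * r + t * s.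
    apply/eqP; rewrite -(eqn_pmul2l p0) -(eqn_pmul2l p0) -(eqn_pmul2l p0).
    apply/eqP; move: E; clear => E.
    have -> : p * (p * (p * (m * (t * s * r)))) = m * (t * p * (s * p) * (r * p)).
      by ring.
    by rewrite E; ring.
  have A1 : s * r <= t * s * r by rewrite -mulnA leq_pmull.
  have A2 : t * r <= t * s * r by rewrite mulnAC leq_pmulr.
  have A3 : t * s <= t * s * r by rewrite leq_pmulr.
  have A4 : 4 * (t * s * r) <= m * (t * s * r) by rewrite leq_mul2r m3 orbT.
  have : 0 < t * s * r by rewrite !muln_gt0 t0 s0.
  by move: A4; rewrite E'; clear -A1 A2 A3; lia.
- right; apply: (key2 z x y) => //; lia.
- right; apply: (key2 y x z) => //; lia.
- left; apply: (key1 x y z) => //; lia.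
- right; apply: (key2 x y z) => //; lia.
- left; apply: (key1 y x z) => //; lia.
- left; apply: (key1 z x y) => //; lia.
Qed.

(** * Primes between n and 2n *)

Lemma central_binS n : n.+1 * 'C(n.+1.*2, n.+1) = (n.*2.+1).*2 * 'C(n.*2, n).
Proof.
have E1 : n.+1 * 'C(n.*2.+1, n.+1) = n.*2.+1 * 'C(n.*2, n) by rewrite -mul_bin_diag.
have E2 : n.+1 * 'C(n.+1.*2, n.+1) = n.+1.*2 * 'C(n.*2.+1, n).
  by rewrite doubleS -mul_bin_diag.
have E3 : 'C(n.*2.+1, n) = 'C(n.*2.+1, n.+1).
  rewrite -[RHS]bin_sub; last by rewrite ltnS -addnn leq_addr.
  by congr 'C(_, _); rewrite -addnn; lia.
by rewrite E2 E3 -doubleMl E1 doubleMl.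
Qed.

Lemma leq_exp4_central_bin n : 0 < n -> 4 ^ n <= n.*2 * 'C(n.*2, n).
Proof.
case: n => // n _; elim: n => [|n IH]; first by [].
have E := central_binS n.+1.
rewrite expnS; apply: (leq_trans (leq_mul (leqnn 4) IH)).
have -> : n.+2.*2 * 'C(n.+2.*2, n.+2) = 2 * (n.+2 * 'C(n.+2.*2, n.+2)).
  by rewrite -mul2n mulnA.
rewrite E !mulnA leq_mul2r; apply/orP; right; lia.
Qed.

(** The binomial is one of two equal terms in the expansion of [(1 + 1)^(2k + 1) = 2 * 4^k]. *)
Lemma leq_mid_bin k : 'C(k.*2.+1, k) <= 4 ^ k.
Proof.
have := expnDn 1 1 k.*2.+1.
under eq_bigr do rewrite !exp1n !muln1.
rewrite addn1 => H.
have kk : k < k.*2.+2 by lia.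
have kk1 : k.+1 < k.*2.+2 by lia.
move: H; rewrite (bigD1 (Ordinal kk)) //= (bigD1 (Ordinal kk1)) /=; last first.
  by rewrite -val_eqE /=; lia.
have -> : 'C(k.*2.+1, k.+1) = 'C(k.*2.+1, k).
  rewrite -[LHS]bin_sub; last by lia.
  by congr 'C(_, _); lia.
set S := (X in _ = _ + (_ + X)); move: S => S.
have E4 : 2 ^ k.*2 = 4 ^ k by rewrite -muln2 mulnC expnM.
rewrite expnS E4; lia.
Qed.

Lemma prod_primes_dvdn (a b N : nat) :
  (forall p, prime p -> a <= p < b -> p %| N) ->
  \prod_(a <= p < b | prime p) p %| N.
Proof.
move=> H; elim: b H => [|b IH] H; first by rewrite big_geq.
have {}IH : \prod_(a <= p < b | prime p) p %| N.
  by apply: IH => p pp /andP[ap pb]; apply: H; rewrite // ap ltnS ltnW.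
have [ab|ba] := leqP a b; last by rewrite big_geq.
rewrite big_mkcond big_nat_recr //= -big_mkcond /=; case: ifP => pb; last by rewrite muln1.
rewrite Gauss_dvd; first by rewrite IH H // ab /=.
rewrite coprime_sym big_nat_cond; elim/big_rec: _ => [|p x]; first exact: coprimen1.
move=> /andP[/andP[_ ltpb] pp] cx; rewrite coprimeMr cx andbT prime_coprime //.
by rewrite dvdn_prime2 // neq_ltn ltpb orbT.
Qed.

(** An even [n > 2] adds no prime; for [n = 2k + 1] the primes in [(k + 1, 2k + 1]] all divide
    ['C(2k + 1, k)], which is at most [4^k]. *)
Lemma primorial_le n : \prod_(0 <= p < n.+1 | prime p) p <= 4 ^ n.
Proof.
have [N] := ubnP n; elim: N n => // N IH n; rewrite ltnS => nN.
have [n2|n2] := leqP n 2.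
  by case: n n2 {nN} => [|[|[|//]]] _; rewrite unlock.
have [en|on] := boolP (odd n); last first.
  have n1 : n = n.-1.+1 by lia.
  rewrite big_mkcond big_nat_recr //= -big_mkcond /= ifN ?muln1; last first.
    by apply: contra on => /even_prime[|//] E; rewrite E in n2.
  rewrite [X in \prod_(0 <= p < X | _) _]n1.
  by apply: (leq_trans (IH _ _)); [lia | rewrite leq_pexp2l // leq_pred].
have [k Ek] : exists k, n = k.*2.+1 by exists n./2; rewrite -[LHS]odd_double_half en.
have k0 : 0 < k by lia.
rewrite (@big_cat_nat _ _ _ k.+2) //=; last by lia.
apply: (@leq_trans (4 ^ k.+1 * 4 ^ k)); last by rewrite -expnD leq_pexp2l //; lia.
apply: leq_mul; first by apply: IH; lia.
apply: leq_trans (leq_mid_bin k); apply: dvdn_leq; first by rewrite bin_gt0; lia.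
rewrite Ek; apply: prod_primes_dvdn => p pp /andP[kp pk].
have H : 'C(k.*2.+1, k) * (k`! * k.+1`!) = (k.*2.+1)`!.
  by rewrite -(@bin_fact k.*2.+1 k); [congr (_ * (_ * _`!)); lia | lia].
have nf j : j < p -> ~~ (p %| j`!).
  elim: j => [_|j IHj jp]; first by rewrite fact0 dvdn1; case: eqP pp => // ->.
  by rewrite factS Euclid_dvdM // (negPf (IHj (ltnW jp))) gtnNdvd.
have A : ~~ (p %| k`!) by apply: nf; lia.
have B : ~~ (p %| k.+1`!) by apply: nf; lia.
have : p %| (k.*2.+1)`! by rewrite dvdn_fact // prime_gt0 //=; lia.
by rewrite -H Euclid_dvdM // (Euclid_dvdM k`!) // (negPf A) (negPf B) !orbF.
Qed.

Lemma logn_central_bin p n : prime p ->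
  logn p 'C(n.*2, n) = \sum_(1 <= k < n.*2.+1) (n.*2 %/ p ^ k - (n %/ p ^ k).*2).
Proof.
move=> pp.
have le k : (n %/ p ^ k).*2 <= n.*2 %/ p ^ k.
  have q0 : 0 < p ^ k by rewrite expn_gt0 prime_gt0.
  by rewrite leq_divRL // -doubleMl leq_double leq_trunc_div.
have H : 'C(n.*2, n) * (n`! * n`!) = (n.*2)`!.
  by rewrite -(@bin_fact n.*2 n) -?addnn ?leq_addr // addnK.
have c0 : 0 < 'C(n.*2, n) by rewrite bin_gt0 -addnn leq_addr.
have := congr1 (logn p) H; rewrite !lognM ?muln_gt0 ?fact_gt0 // !logn_fact // => E.
have wid : \sum_(1 <= k < n.+1) n %/ p ^ k = \sum_(1 <= k < n.*2.+1) n %/ p ^ k.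
  rewrite [RHS](@big_cat_nat _ _ _ n.+1) //=; last by rewrite ltnS -addnn leq_addr.
  rewrite [X in _ = _ + X]big_nat_cond [X in _ = _ + X]big1 ?addn0 // => k /andP[/andP[nk _] _].
  by rewrite divn_small // (leq_trans nk) // ltnW // ltn_expl // prime_gt1.
rewrite sumnB => [|k _]; last exact: le.
rewrite -E wid.
under [X in _ - X]eq_bigr do rewrite -addnn.
by rewrite big_split /= addnK.
Qed.

Lemma double_divn_le n d : 0 < d -> n.*2 %/ d - (n %/ d).*2 <= 1.
Proof.
move=> d0; rewrite leq_subLR addn1 -ltnS ltn_divLR //.
by have := ltn_ceil n d0; lia.
Qed.

(** Each term of Legendre's formula is at most 1, and it vanishes once [p^k > 2n]. *)
Lemma expn_logn_central_bin_le p n : 0 < n -> prime p -> p ^ logn p 'C(n.*2, n) <= n.*2.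
Proof.
move=> n0 pp; have n20 : 0 < n.*2 by rewrite double_gt0.
apply: leq_trans (trunc_logP (prime_gt1 pp) n20).
rewrite leq_exp2l ?prime_gt1 // logn_central_bin //.
set t := trunc_log p n.*2.
have tn : t <= n.*2.
  rewrite -ltnS; apply: leq_trans (ltn_expl t (prime_gt1 pp)) _.
  by rewrite ltnW // ltnS trunc_logP ?prime_gt1.
rewrite (@big_cat_nat _ _ _ t.+1) //= [X in _ + X]big_nat_cond.
rewrite [X in _ + X]big1 ?addn0 => [|k /andP[/andP[tk _] _]]; last first.
  rewrite divn_small //; apply: leq_trans (trunc_log_ltn _ (prime_gt1 pp)) _.
  by rewrite leq_exp2l ?prime_gt1.
apply: leq_trans (leq_sum _ (fun k _ => double_divn_le n _)) _.
  by move=> k; rewrite expn_gt0 prime_gt0.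
by rewrite sum_nat_const_nat muln1 subn1.
Qed.

Lemma logn_central_bin_le1 p n : 0 < n -> prime p -> n.*2 < p ^ 2 ->
  logn p 'C(n.*2, n) <= 1.
Proof.
move=> n0 pp lt; rewrite -ltnS -(ltn_exp2l _ _ (prime_gt1 pp)).
exact: leq_ltn_trans (expn_logn_central_bin_le n0 pp) lt.
Qed.

Lemma logn_central_bin_eq0 p n : prime p -> 2 < p -> p <= n -> n.*2 < 3 * p ->
  logn p 'C(n.*2, n) = 0.
Proof.
move=> pp p2 pn lt; rewrite logn_central_bin // big_nat_cond big1 // => k.
case/andP=> /andP[k1 _] _; apply/eqP; rewrite subn_eq0.
have p0 := prime_gt0 pp.
have [k2|k2] := leqP 2 k.
  rewrite [n.*2 %/ _]divn_small //; apply: (leq_trans lt).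
  by apply: (@leq_trans (p ^ 2)); [rewrite -mulnn leq_mul2r p2 orbT | rewrite leq_pexp2l].
have -> : k = 1 by lia.
rewrite expn1; have : 1 <= n %/ p by rewrite divn_gt0.
have : n.*2 %/ p < 3 by rewrite ltn_divLR.
lia.
Qed.

(** In ['C(2n, n)] a prime up to [s] contributes at most [2n]; the primes in [(s, 2n/3]] occur at
    most once, with product at most [4^(2n/3)]; those in [(2n/3, n]] do not occur; each prime in
    [(n, 2n)] contributes at most [2n]. The final 1 in the exponent pays for the factor [2n] in
    [4^n <= 2n 'C(2n, n)]. *)
Lemma leq_exp4_primes n s : 2 < n -> n.*2 < s.+1 ^ 2 -> s.*2 <= n ->
  4 ^ n <= n.*2 ^ (count prime (index_iota n.+1 n.*2) + s + 1) * 4 ^ (n.*2 %/ 3).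
Proof.
move=> n2 ns sn; have n0 : 0 < n by lia.
have s2 : 1 < s by move: ns; case: (s) => [|[|]] //; lia.
set r := n.*2 %/ 3; set N := 'C(n.*2, n).
have N0 : 0 < N by rewrite bin_gt0 -addnn leq_addr.
apply: leq_trans (leq_exp4_central_bin n0) _.
rewrite addn1 expnS -mulnA leq_mul2l; apply/orP; right.
rewrite -/N -(partnT N0) (@widen_partn (N + n.*2)) ?leq_addr //.
(* The ranges may overlap: each of the three factors is at least 1, so [f p] bounds the contribution
   of [p] as soon as one factor does, and the product of [f] splits in three. *)
pose f p := (if (0 < p <= s) then n.*2 else 1) * (if prime p && (p < r.+1) then p else 1)
  * (if prime p && (n < p < n.*2) then n.*2 else 1).
have f1 p : 1 <= f p.
  rewrite /f !muln_gt0 -andbA; apply/and3P; split; case: ifP => //; try lia.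
  by case/andP=> /prime_gt0.
have fP p : p ^ logn p N <= f p.
  have [pp|pp] := boolP (prime p); last by rewrite /logn (negPf pp).
  have p0 := prime_gt0 pp.
  have n2' : 0 < n.*2 by lia.
  have [ps|sp] := leqP p s.
    apply: leq_trans (expn_logn_central_bin_le n0 pp) _.
    rewrite /f p0 ps -mulnA leq_pmulr // muln_gt0; apply/andP; split; case: ifP => //; lia.
  have p2n : n.*2 < p ^ 2 by apply: (leq_trans ns); rewrite leq_exp2r.
  have L1 := logn_central_bin_le1 n0 pp p2n.
  have pL : p ^ logn p N <= p by rewrite -[X in _ <= X]expn1 leq_exp2l ?prime_gt1.
  have [pr|rp] := leqP p r.
    apply: (leq_trans pL); rewrite /f pp ltnS pr /= mulnAC leq_pmull // muln_gt0.
    apply/andP; split; case: ifP => //; lia.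
  have [pn|np] := leqP p n.
    rewrite logn_central_bin_eq0 ?expn0 //.
      exact: leq_ltn_trans s2 sp.
    by move: rp; rewrite /r ltn_divLR // mulnC.
  have [pn2|np2] := ltnP p n.*2.
    apply: (leq_trans pL); apply: (leq_trans (ltnW pn2)).
    rewrite /f pp np pn2 /= leq_pmull // muln_gt0.
    by apply/andP; split; case: ifP => //; lia.
  have pn2 : n.*2 < p.
    rewrite ltn_neqAle np2 andbT; apply/eqP => E.
    by have [p2|] := even_prime pp; [lia | rewrite -E odd_double].
  have -> : logn p N = 0; last by rewrite expn0.
  apply/eqP; rewrite -leqn0 -ltnS -(ltn_exp2l _ _ (prime_gt1 pp)) expn1.
  exact: leq_ltn_trans (expn_logn_central_bin_le n0 pp) pn2.
have wid (g : nat -> nat) a : a <= (N + n.*2).+1 -> (forall p, a <= p -> g p = 1) ->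
    \prod_(0 <= p < (N + n.*2).+1) g p = \prod_(0 <= p < a) g p.
  move=> ale g1; rewrite (@big_cat_nat _ _ _ a) //= [X in _ * X]big_nat_cond.
  by rewrite [X in _ * X]big1 ?muln1 // => p /andP[/andP[/g1]].
apply: (@leq_trans (\prod_(0 <= p < (N + n.*2).+1) f p)).
  by apply: leq_prod => p _; apply: fP.
rewrite /f !big_split /= [X in _ <= X](_ : _ =
  n.*2 ^ s * 4 ^ r * n.*2 ^ count prime (index_iota n.+1 n.*2)); last first.
  by rewrite expnD -mulnA mulnC.
apply: leq_mul; first apply: leq_mul.
- rewrite (wid _ s.+1) => [||p sp]; last by rewrite [p <= s]leqNgt sp andbF.
    rewrite big_nat_recl // mul1n; under eq_big_nat => i /andP[_ i1] do rewrite ltn0Sn i1.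
    by rewrite prod_nat_const_nat subn0.
  by lia.
- rewrite (wid _ r.+1) => [||p rp].
  - apply: leq_trans (primorial_le r); rewrite [X in _ <= X]big_mkcond /=.
    by rewrite leq_eqVlt; apply/orP; left; apply/eqP/eq_big_nat => p /andP[_ ->]; rewrite andbT.
  - by rewrite ltnS /r; lia.
  - by rewrite [p < _]ltnNge rp andbF.
- rewrite (wid _ n.*2) => [||p np]; [| lia | by rewrite [p < _]ltnNge np !andbF].
  rewrite (@big_cat_nat _ _ _ n.+1) //=; last lia.
  rewrite [X in X * _]big_nat_cond [X in X * _]big1 ?mul1n => [|p]; last first.
    by case/andP=> /andP[_ pn] _; rewrite [n < p]ltnNge -ltnS pn andbF.
  rewrite (eq_big_nat _ _ (F2 := fun p => if prime p then n.*2 else 1)) => [|p /andP[np pn]].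
    by rewrite -big_mkcond big_const_seq; elim: (count _ _) => //= k IH; rewrite expnS leq_mul2l IH orbT.
  by rewrite np pn !andbT.
Qed.

(** * The divisor function on arithmetic progressions *)

Lemma size_divisors_pfactorM q v M : prime q -> 0 < M ->
  size (divisors (q ^ v * M)) <= v.+1 * size (divisors M).
Proof.
move=> pq M0.
have N0 : 0 < q ^ v * M by rewrite muln_gt0 expn_gt0 prime_gt0.
have -> : v.+1 * size (divisors M) =
    size [seq q ^ i * d | i <- iota 0 v.+1, d <- divisors M].
  by rewrite size_allpairs size_iota.
apply: uniq_leq_size; first exact: divisors_uniq.
move=> f; rewrite -dvdn_divisors // => fd.
have f0 : 0 < f by apply: dvdn_gt0 fd.
have [r cqr Ef] := pfactor_coprime pq f0.
have Hr : r %| M.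
  rewrite -(@Gauss_dvdr r (q ^ v)); last by rewrite coprime_sym coprimeXl.
  by apply: dvdn_trans fd; rewrite Ef dvdn_mulr.
have [lelv|ltvl] := leqP (logn q f) v.
  apply/allpairsP; exists (logn q f, r); split; last by rewrite mulnC.
    by rewrite mem_iota.
  by rewrite -dvdn_divisors.
(* [q] may divide [M]; a divisor with more than [v] factors [q] is then [q^v] times a divisor of
   [M]. *)
apply/allpairsP; exists (v, f %/ q ^ v).
have qf : q ^ v %| f by rewrite Ef dvdn_mull // dvdn_exp2l // ltnW.
split; [by rewrite mem_iota ltnS leqnn | rewrite -dvdn_divisors //= | by rewrite mulnC divnK].
by rewrite -(@dvdn_pmul2l (q ^ v)) ?expn_gt0 ?prime_gt0 // mulnC divnK.
Qed.

(* An entry (q, H) satisfies H / 1000 >= max_v (v + 1) / q^(v/6); for a prime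
   q >= 64 that maximum is 1, so the divisor bound below needs no further weight. *)
Definition divisor_weights : seq (nat * nat) :=
  [:: (2, 3572); (3, 2404); (5, 1789); (7, 1569); (11, 1349); (13, 1305);
      (17, 1248); (19, 1225); (23, 1186); (29, 1142); (31, 1129); (37, 1096);
      (41, 1078); (43, 1069); (47, 1053); (53, 1032); (59, 1014); (61, 1009)].

Lemma N_to_nat_pow n k :
  BinNat.N.to_nat (BinNat.N.pow (BinNat.N.of_nat n) (BinNat.N.of_nat k)) = n ^ k.
Proof.
elim: k => [|k IH]; first by [].
by rewrite Nnat.Nat2N.inj_succ BinNat.N.pow_succ_r' Nnat.N2Nat.inj_mul IH Nnat.Nat2N.id expnS.
Qed.

(* Checked in binary arithmetic: the numbers are too large for unary naturals. *)
Lemma divisor_weights_small q H v : (q, H) \in divisor_weights -> v <= 8 ->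
  v.+1 ^ 6 * 1000 ^ 6 <= q ^ v * H ^ 6.
Proof.
pose pw n k := BinNat.N.pow (BinNat.N.of_nat n) (BinNat.N.of_nat k).
pose a v := BinNat.N.mul (pw v.+1 6) (pw 1000 6).
pose b q H v := BinNat.N.mul (pw q v) (pw H 6).
have : all (fun x => all (fun v => BinNat.N.eqb
    (BinNat.N.add (a v) (BinNat.N.sub (b x.1 x.2 v) (a v))) (b x.1 x.2 v))
    (iota 0 9)) divisor_weights by vm_compute.
move=> /allP ok /ok /allP/(_ v); rewrite mem_iota ltnS => le /le /BinNat.N.eqb_eq.
move=> /(congr1 BinNat.N.to_nat).
rewrite Nnat.N2Nat.inj_add {2}/b /a !Nnat.N2Nat.inj_mul !N_to_nat_pow plusE !multE [(q, H).1]/= [(q, H).2]/= => <-.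
exact: leq_addr.
Qed.

Local Open Scope ring_scope.

(** * Sixth roots and the weight of an integer *)

Lemma sixth_root_exists (R : rcfType) (n : nat) :
  exists x : R, (0 <= x) && (x ^+ 6 == n%:R).
Proof.
have [|x /andP[x0 _]] := @poly_ivt R ('X^6 - n%:R%:P) 0 n.+1%:R (ler0n _ _).
  rewrite !hornerE expr0n /= sub0r oppr_le0 ler0n /= subr_ge0.
  apply: (@le_trans _ _ n.+1%:R); first by rewrite ler_nat.
  by rewrite -natrX ler_nat -[X in (X <= _)%N]expn1 leq_pexp2l.
by rewrite rootE !hornerE subr_eq0 => E; exists x; rewrite x0.
Qed.

(** Any real closed field contains these roots, so all estimates stay algebraic; the theorem takes
    the real closure of the rationals. *)
Definition root6 (R : rcfType) (n : nat) : R := xchoose (sixth_root_exists R n).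

Lemma root6_ge0 (R : rcfType) n : 0 <= root6 R n.
Proof. by have /andP[] := xchooseP (sixth_root_exists R n). Qed.

Lemma root6X (R : rcfType) n : root6 R n ^+ 6 = n%:R.
Proof. by have /andP[_ /eqP] := xchooseP (sixth_root_exists R n). Qed.

Lemma ler_sixth (R : rcfType) (x y : R) :
  0 <= x -> 0 <= y -> x ^+ 6 <= y ^+ 6 -> x <= y.
Proof. by move=> x0 y0; rewrite ler_pXn2r. Qed.

Lemma root6M (R : rcfType) a b : root6 R (a * b)%N = root6 R a * root6 R b.
Proof.
apply/eqP; rewrite -(@eqrXn2 _ 6) ?mulr_ge0 ?root6_ge0 //.
by rewrite exprMn !root6X natrM.
Qed.

Lemma root6_gt0 (R : rcfType) n : (0 < n)%N -> 0 < root6 R n.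
Proof.
move=> n0; rewrite lt_def root6_ge0 andbT; apply/eqP => E.
by have := root6X R n; rewrite E expr0n /= => /esym/eqP; rewrite pnatr_eq0; case: n n0 {E}.
Qed.

Lemma root6_1 (R : rcfType) : root6 R 1 = 1.
Proof. by apply/eqP; rewrite -(@eqrXn2 _ 6) ?root6_ge0 ?root6X ?expr1n. Qed.

Definition weight_at (R : rcfType) (H : nat) : R := H%:R / 1000%:R.

Definition weight (R : rcfType) (t : seq (nat * nat)) (N : nat) : R :=
  \prod_(x <- t | (x.1 %| N)%N) weight_at R x.2.

(** From [v = 8] on, one step multiplies the left side by at most [(10/9)^6 < 2 <= q], so a finite
    check decides all [v]. *)
Lemma succ_exp6_le_small (R : rcfType) (q : nat) (h : R) :
  (1 < q)%N -> (forall v : nat, (v <= 8)%N -> v.+1%:R ^+ 6 <= q%:R ^+ v * h) ->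
  forall v : nat, v.+1%:R ^+ 6 <= q%:R ^+ v * h.
Proof.
move=> q1 small; elim=> [|v IH]; first exact: small.
have [/small //|lt8v] := leqP v.+1 8.
apply: (@le_trans _ _ (q%:R * v.+1%:R ^+ 6)); last first.
  by rewrite [q%:R ^+ v.+1]exprS -mulrA ler_wpM2l.
apply: (@le_trans _ _ (2%:R * v.+1%:R ^+ 6)); last first.
  by rewrite ler_wpM2r ?exprn_ge0 // ler_nat.
have v8 : 9%:R <= v.+1%:R :> R by rewrite ler_nat.
rewrite [v.+2%:R]mulrS; move: (v.+1%:R : R) v8 => w w9.
have -> : (1 + w) ^+ 6 = ((1 + w) ^+ 2) ^+ 3 by rewrite -exprM.
have H : (1 + w) ^+ 2 <= 100%:R / 81%:R * w ^+ 2 by rewrite !expr2; nra.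
apply: (@le_trans _ _ ((100%:R / 81%:R * w ^+ 2) ^+ 3)).
  by rewrite ler_pXn2r ?nnegrE ?sqr_ge0 // mulr_ge0 ?sqr_ge0 //; lra.
rewrite exprMn -exprM ler_wpM2r ?exprn_ge0 //; lra.
Qed.

Lemma succ_exp6_le_weight (R : rcfType) (q H v : nat) :
  (q, H) \in divisor_weights ->
  v.+1%:R ^+ 6 <= q%:R ^+ v * weight_at R H ^+ 6.
Proof.
move=> qH; apply: succ_exp6_le_small => [|u u8].
  by have /allP/(_ _ qH) : all (fun x => 1 < x.1)%N divisor_weights by [].
rewrite /weight_at expr_div_n mulrA ler_pdivlMr ?exprn_gt0 ?ltr0n //.
by rewrite -!natrX -!natrM ler_nat divisor_weights_small.
Qed.

Lemma weight_ge0 (R : rcfType) t N : 0 <= weight R t N.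
Proof. by apply: prodr_ge0 => x _; rewrite divr_ge0. Qed.

Lemma weight_cons (R : rcfType) q H t N :
  weight R ((q, H) :: t) N = (if (q %| N)%N then weight_at R H else 1) * weight R t N.
Proof. by rewrite /weight big_cons /=; case: ifP; rewrite ?mul1r. Qed.

Lemma weight_pfactorM (R : rcfType) t q v M :
  prime q -> (0 < v)%N -> ~~ (q %| M)%N -> all prime (map fst t) ->
  weight R t (q ^ v * M)%N =
    (\prod_(x <- t | x.1 == q) weight_at R x.2) * weight R t M.
Proof.
move=> pq v0 qM; elim: t => [|[p H] t IH] /=; first by rewrite /weight !big_nil mulr1.
case/andP=> pp /IH {}IH; rewrite !weight_cons IH big_cons /=.
rewrite Euclid_dvdM // Euclid_dvdX // v0 andbT dvdn_prime2 //.
have [-> /=|npq /=] := eqVneq p q; last by rewrite mulrCA.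
by rewrite (negPf qM) mul1r mulrA.
Qed.

Lemma weight_at_uniq (R : rcfType) (t : seq (nat * nat)) q H :
  uniq (map fst t) -> (q, H) \in t ->
  \prod_(x <- t | x.1 == q) weight_at R x.2 = weight_at R H.
Proof.
elim: t => // [[p K] t IH] /= /andP[pt ut]; rewrite inE big_cons /=.
have [<-|npq] := eqVneq p q; last first.
  by rewrite xpair_eqE eq_sym (negPf npq) /=; apply: IH.
have nt J : ((p, J) \in t) = false by apply: contraNF pt => /(map_f fst).
rewrite xpair_eqE eqxx nt orbF => /eqP ->.
rewrite big1_seq ?mulr1 // => x /andP[/eqP x1 xt].
by move: (nt x.2); rewrite -x1 -surjective_pairing xt.
Qed.

Lemma succ_le_weight (R : rcfType) q v : prime q ->
  v.+1%:R <= root6 R (q ^ v) * \prod_(x <- divisor_weights | x.1 == q) weight_at R x.2.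
Proof.
move=> pq; apply: ler_sixth => //.
  by rewrite mulr_ge0 ?root6_ge0 //; apply: prodr_ge0 => x _; rewrite divr_ge0.
rewrite exprMn root6X natrX.
have [lt64|le64] := ltnP q 64; last first.
  rewrite big1_seq => [|x /andP[/eqP xq xw]]; last first.
    have /allP/(_ _ xw) : all (fun x => x.1 < 64)%N divisor_weights by [].
    by rewrite xq ltnNge le64.
  rewrite expr1n mulr1 -!natrX ler_nat.
  (* As [64 = 2^6], this is the sixth power of [v + 1 <= 2^v]. *)
  apply: (@leq_trans (64 ^ v)%N); last by case: v => // v; rewrite leq_exp2r.
  elim: v => [//|v IH].
  apply: (@leq_trans (2 ^ 6 * v.+1 ^ 6)%N); last by rewrite (expnS 64); apply: leq_mul.
  by rewrite -expnMn leq_exp2r // mul2n -addnn addSn ltnS leq_addl.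
have /allP/(_ q) : all (fun q => prime q ==> (q \in map fst divisor_weights)) (iota 0 64) by [].
rewrite mem_iota lt64 pq => /(_ isT) /mapP[[p H] qH /= qp]; rewrite -qp in qH *.
by rewrite (weight_at_uniq _ _ qH) //; exact: succ_exp6_le_weight.
Qed.

Lemma size_divisors_le (R : rcfType) N : (0 < N)%N ->
  (size (divisors N))%:R <= root6 R N * weight R divisor_weights N.
Proof.
have [n] := ubnP N; elim: n N => // n IH N ltNn N0.
have [->|N1] := eqVneq N 1%N.
  rewrite root6_1 mul1r /weight big1_seq // => x /andP[].
  rewrite dvdn1 => /eqP x1 xw.
  by have /allP/(_ _ xw) : all (fun x => x.1 != 1)%N divisor_weights by []; rewrite x1.
have pq : prime (pdiv N) by rewrite pdiv_prime // ltn_neqAle eq_sym N1.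
have [M cqM EN] := pfactor_coprime pq N0.
set q := pdiv N in pq cqM EN; set v := logn q N in EN.
have v0 : (0 < v)%N by rewrite logn_gt0 mem_primes pq N0 pdiv_dvd.
have M0 : (0 < M)%N by move: N0; rewrite EN muln_gt0 => /andP[].
have qM : ~~ (q %| M)%N by rewrite -prime_coprime.
have ltMn : (M < n)%N.
  apply: (@leq_trans N) => //; rewrite EN -[X in (X <= _)%N]muln1 ltn_pmul2l //.
  by rewrite -(exp1n v) ltn_exp2r // prime_gt1.
rewrite EN mulnC root6M (weight_pfactorM _ pq v0 qM) //.
apply: (@le_trans _ _ (v.+1%:R * (size (divisors M))%:R)).
  by rewrite -natrM ler_nat size_divisors_pfactorM.
by rewrite mulrACA ler_pM // ?succ_le_weight // IH.
Qed.

(** The induction over the table confines [x] to a residue class modulo [q], which turns [M] into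
    [M q]; hence progressions instead of intervals, with a modulus prime to the primes still in [t].
    Of [nu] only its zeros modulo each prime matter: at most one class for 2 and two for an odd
    prime. *)
Definition ap_weight_bound (R : rcfType) (t : seq (nat * nat)) (c G : R) :=
  forall (nu : nat -> nat) (x0 M L : nat),
    (forall q, prime q -> exists2 rs : seq nat, (size rs <= (q != 2).+1)%N &
       forall x, (q %| nu x)%N -> has (fun r => x == r %[mod q])%N rs) ->
    all (fun x => coprime x.1 M) t ->
    \sum_(0 <= y < L) weight R t (nu (x0 + M * y)%N) <= c * L%:R + G.

Lemma ap_weight_bound_nil (R : rcfType) : ap_weight_bound [::] (1 : R) 0.
Proof.
move=> nu x0 M L _ _; rewrite (eq_bigr (fun=> 1)) => [|i _]; last by rewrite /weight big_nil.
by rewrite big_const_nat iter_addr_0 subn0 addr0 mul1r.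
Qed.

Lemma ler_sum_subset (R : rcfType) (I : eqType) (s1 s2 : seq I) (F : I -> R) :
  uniq s1 -> uniq s2 -> {subset s1 <= s2} -> (forall i, 0 <= F i) ->
  \sum_(i <- s1) F i <= \sum_(i <- s2) F i.
Proof.
move=> u1 u2 s12 F0.
have p12 : perm_eq s1 [seq i <- s2 | i \in s1].
  apply: uniq_perm; rewrite ?filter_uniq // => i; rewrite mem_filter.
  by case: (boolP (i \in s1)) => // /s12 ->.
by rewrite (perm_big _ p12) big_filter big_mkcond; apply: ler_sum => i _; case: ifP.
Qed.

Lemma sum_residue_class_le (R : rcfType) (F : nat -> R) (q s L : nat) :
  (0 < q)%N -> (forall y, 0 <= F y) ->
  \sum_(0 <= y < L | (y %% q == s)%N) F y <=
    \sum_(0 <= z < (L %/ q).+1) F (s + q * z)%N.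
Proof.
move=> q0 F0.
rewrite (eq_bigr (fun y => F (s + q * (y %/ q))%N)) => [|y /eqP <-]; last first.
  by rewrite mulnC addnC -divn_eq.
rewrite -big_filter -(big_map (fun y => y %/ q)%N xpredT (fun z => F (s + q * z)%N)).
apply: ler_sum_subset => //; rewrite ?iota_uniq //.
  rewrite map_inj_in_uniq ?filter_uniq ?iota_uniq // => y y'.
  rewrite !mem_filter => /andP[/eqP ys _] /andP[/eqP ys' _] E.
  by rewrite (divn_eq y q) (divn_eq y' q) E ys ys'.
move=> z /mapP[y]; rewrite mem_filter !mem_index_iota => /andP[_ /andP[_ yL]] ->.
by rewrite ltnS leq_div2r // ltnW.
Qed.

(** If [w] is the weight for [t], the new weight is at most [w] plus [(H/1000 - 1) w] on each root
    class modulo [q]. On such a class the bound for [t] applies to a progression of modulus [M q]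
    with at most [L/q + 1] terms and gives [c (L/q + 1) + G]. Adding up the classes yields the slope
    [c (1 + d/q)] and the constant [G + d (c + G)]. *)
Lemma ap_weight_bound_cons (R : rcfType) q H t (c G c' G' : R) :
  prime q -> (q \notin map fst t) -> all prime (map fst t) ->
  0 <= c -> 0 <= G -> 1 <= weight_at R H ->
  let d := (q != 2).+1%:R * (weight_at R H - 1) in
  c * (1 + d / q%:R) <= c' -> G + d * (c + G) <= G' ->
  ap_weight_bound t c G -> ap_weight_bound ((q, H) :: t) c' G'.
Proof.
move=> pq qt pt c0 G0 H1 d cc' GG' B nu x0 M L roots /= /andP[cqM cM].
have q0 := prime_gt0 pq.
have d0 : 0 <= d by rewrite mulr_ge0 ?subr_ge0.
pose w y := weight R t (nu (x0 + M * y)%N).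
have w0 y : 0 <= w y by apply: weight_ge0.
have [rs szrs rsP] := roots q pq.
have split y : weight R ((q, H) :: t) (nu (x0 + M * y)%N) <=
    w y + (weight_at R H - 1) *
      \sum_(r <- rs) (if (x0 + M * y == r %[mod q])%N then w y else 0).
  rewrite weight_cons -/(w y).
  have s0 r : 0 <= (if (x0 + M * y == r %[mod q])%N then w y else 0) by case: ifP.
  case: ifP => [/rsP /hasP[r rrs Er]|_]; last first.
    by rewrite mul1r lerDl mulr_ge0 ?subr_ge0 //; apply: sumr_ge0.
  have -> : weight_at R H * w y = w y + (weight_at R H - 1) * w y by ring.
  rewrite lerD2l ler_wpM2l ?subr_ge0 //.
  by rewrite (big_rem r) //= Er lerDl; apply: sumr_ge0.
have cls r : \sum_(0 <= y < L) (if (x0 + M * y == r %[mod q])%N then w y else 0) <=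
    c * (L%:R / q%:R + 1) + G.
  have rhs0 : 0 <= c * (L%:R / q%:R + 1) + G.
    by rewrite addr_ge0 ?mulr_ge0 ?addr_ge0 ?divr_ge0.
  rewrite -big_mkcond /=.
  have [s /eqP Es|none] := pickP (fun s : 'I_q => (x0 + M * s)%N == r %[mod q]); last first.
    rewrite big_pred0 // => y; have := none (Ordinal (ltn_pmod y q0)).
    by rewrite /= -modnDmr -modnMmr modn_mod modnMmr modnDmr.
  rewrite (eq_bigl (fun y => (y %% q == s)%N)) => [|y]; last first.
    rewrite -Es eqn_modDl /=.
    have wl a b : (a <= b)%N -> (M * b == M * a %[mod q])%N = (b == a %[mod q])%N.
      move=> ab; rewrite !eqn_mod_dvd ?leq_mul2l ?ab ?orbT // -mulnBr Gauss_dvdr //.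
    have [ys|/ltnW sy] := leqP y s.
      by rewrite eq_sym wl // eq_sym [(s %% q)%N]modn_small.
    by rewrite wl // [(s %% q)%N]modn_small.
  apply: (le_trans (sum_residue_class_le s L q0 w0)).
  have -> : \sum_(0 <= z < (L %/ q).+1) w (s + q * z)%N =
      \sum_(0 <= z < (L %/ q).+1) weight R t (nu ((x0 + M * s) + (M * q) * z)%N).
    by apply: eq_bigr => z _; rewrite /w mulnDr addnA mulnA.
  apply: le_trans (B _ _ _ _ roots _) _.
    apply/allP => x xt; rewrite coprimeMr (allP cM) //= prime_coprime; last first.
      by apply: (allP pt); apply: map_f.
    have px : prime x.1 by apply: (allP pt); apply: map_f.
    by rewrite dvdn_prime2 //; apply/eqP => E; move: qt; rewrite -E map_f.
  rewrite lerD2r ler_wpM2l // -addn1 natrD lerD2r ler_pdivlMr ?ltr0n // -natrM ler_nat.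
  exact: leq_trunc_div.
apply: le_trans (ler_sum _ (fun y _ => split y)) _.
rewrite big_split /= -mulr_sumr exchange_big /=.
have S1 := B nu x0 M L roots cM.
have S2 : \sum_(r <- rs) \sum_(0 <= y < L)
    (if (x0 + M * y == r %[mod q])%N then w y else 0) <=
    (q != 2).+1%:R * (c * (L%:R / q%:R + 1) + G).
  apply: le_trans (ler_sum _ (fun r _ => cls r)) _.
  rewrite big_const_seq count_predT iter_addr_0 -[X in X <= _]mulr_natl ler_wpM2r ?ler_nat //.
  by rewrite addr_ge0 ?mulr_ge0 ?addr_ge0 ?divr_ge0.
apply: le_trans (lerD S1 (ler_wpM2l _ S2)) _; first by rewrite subr_ge0.
have -> : (weight_at R H - 1) * ((q != 2).+1%:R * (c * (L%:R / q%:R + 1) + G)) =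
   d * (c * (L%:R / q%:R + 1) + G) by rewrite /d; ring.
have L0 : 0 <= L%:R :> R by [].
have := ler_wpM2r L0 cc'; rewrite mulrDr mulrDl mulr1; lra.
Qed.

(** The pairs follow the recursion of [ap_weight_bound_cons], started at [(1, 0)] beyond 61 and run
    down to 2 with upward rounding; each application names the pair of the remaining tail. *)
Lemma divisor_weights_bound (R : rcfType) :
  ap_weight_bound divisor_weights (4215%:R / 500%:R : R) 2007%:R.
Proof.
apply: (@ap_weight_bound_cons R _ _ _ (3687%:R / 1000%:R) (559%:R / 1%:R));
  rewrite /weight_at //=; try lra.
apply: (@ap_weight_bound_cons R _ _ _ (1904%:R / 1000%:R) (1453%:R / 10%:R));
  rewrite /weight_at //=; try lra.
apply: (@ap_weight_bound_cons R _ _ _ (1447%:R / 1000%:R) (2772%:R / 50%:R));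
  rewrite /weight_at //=; try lra.
apply: (@ap_weight_bound_cons R _ _ _ (1244%:R / 1000%:R) (2526%:R / 100%:R));
  rewrite /weight_at //=; try lra.
apply: (@ap_weight_bound_cons R _ _ _ (1169%:R / 1000%:R) (1439%:R / 100%:R));
  rewrite /weight_at //=; try lra.
apply: (@ap_weight_bound_cons R _ _ _ (1116%:R / 1000%:R) (4255%:R / 500%:R));
  rewrite /weight_at //=; try lra.
apply: (@ap_weight_bound_cons R _ _ _ (1084%:R / 1000%:R) (2664%:R / 500%:R));
  rewrite /weight_at //=; try lra.
apply: (@ap_weight_bound_cons R _ _ _ (1058%:R / 1000%:R) (3346%:R / 1000%:R));
  rewrite /weight_at //=; try lra.
apply: (@ap_weight_bound_cons R _ _ _ (1041%:R / 1000%:R) (2156%:R / 1000%:R));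
  rewrite /weight_at //=; try lra.
apply: (@ap_weight_bound_cons R _ _ _ (1030%:R / 1000%:R) (1451%:R / 1000%:R));
  rewrite /weight_at //=; try lra.
apply: (@ap_weight_bound_cons R _ _ _ (1021%:R / 1000%:R) (944%:R / 1000%:R));
  rewrite /weight_at //=; try lra.
apply: (@ap_weight_bound_cons R _ _ _ (1015%:R / 1000%:R) (628%:R / 1000%:R));
  rewrite /weight_at //=; try lra.
apply: (@ap_weight_bound_cons R _ _ _ (1011%:R / 1000%:R) (406%:R / 1000%:R));
  rewrite /weight_at //=; try lra.
apply: (@ap_weight_bound_cons R _ _ _ (1007%:R / 1000%:R) (234%:R / 1000%:R));
  rewrite /weight_at //=; try lra.
apply: (@ap_weight_bound_cons R _ _ _ (1004%:R / 1000%:R) (115%:R / 1000%:R));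
  rewrite /weight_at //=; try lra.
apply: (@ap_weight_bound_cons R _ _ _ (1002%:R / 1000%:R) (47%:R / 1000%:R));
  rewrite /weight_at //=; try lra.
apply: (@ap_weight_bound_cons R _ _ _ (1001%:R / 1000%:R) (18%:R / 1000%:R));
  rewrite /weight_at //=; try lra.
apply: (@ap_weight_bound_cons R _ _ _ 1 0);
  rewrite /weight_at //=; try lra.
exact: ap_weight_bound_nil.
Qed.

(** For two roots [x], [y], [q] divides [al (y^2 - x^2)] but not [al], so [y] is [x] or [-x] modulo
    [q]; for [q = 2] these coincide. *)
Lemma quadratic_roots (al q : nat) : prime q ->
  exists2 rs : seq nat, (size rs <= (q != 2).+1)%N &
    forall x, (q %| al * x ^ 2 + 1)%N -> has (fun r => x == r %[mod q])%N rs.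
Proof.
move=> pq; have q0 := prime_gt0 pq.
have [[s sq] /= qs|none] := pickP (fun s : 'I_q => q %| al * s ^ 2 + 1)%N; last first.
  exists [::] => // x qx; have := none (Ordinal (ltn_pmod x q0)).
  rewrite /= /dvdn -modnDml -modnMmr modnXm modnMmr modnDml.
  by rewrite -/(q %| _)%N qx.
have qal : ~~ (q %| al)%N.
  apply/negP => H; move: qs; rewrite dvdn_addr ?dvdn_mulr // dvdn1 => /eqP q1.
  by rewrite q1 in pq.
have key x y : (x <= y)%N -> (q %| al * x ^ 2 + 1)%N -> (q %| al * y ^ 2 + 1)%N ->
    (y == x %[mod q])%N || (q %| y + x)%N.
  move=> xy qx qy; rewrite eqn_mod_dvd // -Euclid_dvdM // -subn_sqr.
  have : (q %| al * (y ^ 2 - x ^ 2))%N.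
    by rewrite mulnBr -(subnDr 1); apply: dvdn_sub.
  by rewrite Euclid_dvdM // (negPf qal).
have key2 x : (q %| al * x ^ 2 + 1)%N -> (x == s %[mod q])%N || (q %| x + s)%N.
  move=> qx; have [xs|/ltnW sx] := leqP x s; last exact: key.
  by rewrite eq_sym addnC; apply: key.
have [q2|q2] := eqVneq q 2%N.
  exists [:: s] => // x /key2; rewrite /= orbF => /orP[//|].
  by rewrite q2 dvdn2 oddD !modn2; case: (odd x); case: (odd s).
exists [:: s; (q - s)%N] => // x /key2; rewrite /= orbF => /orP[->//|H].
apply/orP; right; rewrite -(eqn_modDr s) subnK ?(ltnW sq) // modnn.
exact: H.
Qed.

(** The single root is stated in the form of [ap_weight_bound], so that both averages share the same
    constants. *)
Lemma linear_roots (al q : nat) : prime q ->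
  exists2 rs : seq nat, (size rs <= (q != 2).+1)%N &
    forall x, (q %| al * x + 1)%N -> has (fun r => x == r %[mod q])%N rs.
Proof.
move=> pq; have q0 := prime_gt0 pq.
have [[s sq] /= qs|none] := pickP (fun s : 'I_q => q %| al * s + 1)%N; last first.
  exists [::] => // x qx; have := none (Ordinal (ltn_pmod x q0)).
  rewrite /= /dvdn -modnDml modnMmr modnDml.
  by rewrite -/(q %| _)%N qx.
have qal : ~~ (q %| al)%N.
  apply/negP => H; move: qs; rewrite dvdn_addr ?dvdn_mulr // dvdn1 => /eqP q1.
  by rewrite q1 in pq.
have key x y : (x <= y)%N -> (q %| al * x + 1)%N -> (q %| al * y + 1)%N ->
    (y == x %[mod q])%N.
  move=> xy qx qy; rewrite eqn_mod_dvd //.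
  have : (q %| al * (y - x))%N.
    by rewrite mulnBr -(subnDr 1); apply: dvdn_sub.
  by rewrite Euclid_dvdM // (negPf qal).
exists [:: s] => // x qx; rewrite /= orbF.
have [xs|/ltnW sx] := leqP x s; last exact: key.
by rewrite eq_sym; apply: key.
Qed.

Lemma sum_size_divisors_interval (R : rcfType) (nu : nat -> nat) (u L : nat) (B : R) :
  (forall q, prime q -> exists2 rs : seq nat, (size rs <= (q != 2).+1)%N &
     forall x, (q %| nu x)%N -> has (fun r => x == r %[mod q])%N rs) ->
  (forall x, 0 < nu x)%N -> 0 <= B ->
  (forall x, (u <= x < u + L)%N -> root6 R (nu x) <= B) ->
  \sum_(u <= x < u + L) (size (divisors (nu x)))%:R <=
    B * (4215%:R / 500%:R * L%:R + 2007%:R).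
Proof.
move=> roots nu0 B0 nuB.
have S := @divisor_weights_bound R nu u 1 L roots _.
have {}S : \sum_(0 <= y < L) weight R divisor_weights (nu (u + y)%N) <=
    4215%:R / 500%:R * L%:R + 2007%:R.
  have := S _; rewrite (eq_bigr (fun y => weight R divisor_weights (nu (u + y)%N))).
    by apply; apply/allP => x _; rewrite coprimen1.
  by move=> y _; rewrite mul1n.
apply: le_trans (ler_wpM2l B0 S); rewrite -{1}[u]add0n big_addn addKn.
rewrite mulr_sumr; apply: ler_sum_nat => y /andP[_ yL].
rewrite [(y + u)%N]addnC; apply: (le_trans (size_divisors_le R (nu0 _))).
by rewrite ler_wpM2r ?weight_ge0 // nuB // leq_addr ltn_add2l.
Qed.

(** * Sums of powers of sixth roots *)

Lemma root6_le (R : rcfType) a b : (a <= b)%N -> root6 R a <= root6 R b.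
Proof. by move=> ab; apply: ler_sixth; rewrite ?root6_ge0 // !root6X ler_nat. Qed.

Lemma root6_ge1 (R : rcfType) n : (0 < n)%N -> 1 <= root6 R n.
Proof. by move=> n0; rewrite -[1](root6_1 R) root6_le. Qed.

(** For consecutive roots [u], [v] the relation [v^6 = u^6 + 1] turns each comparison of a sum with
    an integral below into a polynomial inequality in [u] and [v]. *)
Lemma root6_step (R : rcfType) n :
  [/\ 0 <= root6 R n, root6 R n <= root6 R n.+1, 0 < root6 R n.+1 &
      root6 R n.+1 ^+ 6 = root6 R n ^+ 6 + 1].
Proof. by split; rewrite ?root6_ge0 ?root6_le ?root6_gt0 // !root6X -natr1. Qed.

Lemma sum_root6_N5 (R : rcfType) n :
  \sum_(1 <= j < n.+1) (root6 R j)^-1 ^+ 5 <= 6 * root6 R n.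
Proof.
elim: n => [|n IH]; first by rewrite big_geq //; rewrite mulr_ge0 ?root6_ge0.
rewrite big_nat_recr //=; apply: (le_trans (lerD IH (lexx _))).
have [u0 uv v0 E] := root6_step R n.
move: (root6 R n) (root6 R n.+1) u0 uv v0 E => u v u0 uv v0 E.
rewrite -lerBrDl -mulrBr exprVn -[X in X <= _]mul1r ler_pdivrMr ?exprn_gt0 //.
have E1 : v ^+ 6 - u ^+ 6 = 1 by rewrite E addrAC subrr add0r.
rewrite -[X in X <= _]E1.
have -> : v ^+ 6 - u ^+ 6 = (v - u) *
  (v ^+ 5 + v ^+ 4 * u + v ^+ 3 * u ^+ 2 + v ^+ 2 * u ^+ 3 + v * u ^+ 4 + u ^+ 5) by ring.
have -> : 6 * (v - u) * v ^+ 5 = (v - u) * (6 * v ^+ 5) by ring.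
rewrite ler_wpM2l ?subr_ge0 //.
have H i j : (i + j = 5)%N -> v ^+ i * u ^+ j <= v ^+ 5.
  move=> <-; rewrite exprD ler_wpM2l ?exprn_ge0 ?(ltW v0) //.
  by rewrite lerXn2r ?nnegrE // (le_trans u0).
have := (H 4 1 erefl, H 3 2 erefl, H 2 3 erefl, H 1 4 erefl, H 0 5 erefl)%N.
by rewrite !expr1 expr0 mul1r => -[[[[? ?] ?] ?] ?]; lra.
Qed.

Lemma sum_root6_N2 (R : rcfType) n :
  \sum_(1 <= j < n.+1) (root6 R j)^-1 ^+ 2 <= 3 / 2 * root6 R n ^+ 4.
Proof.
elim: n => [|n IH]; first by rewrite big_geq //; rewrite !mulr_ge0 ?invr_ge0 ?exprn_ge0 ?root6_ge0.
rewrite big_nat_recr //=; apply: (le_trans (lerD IH (lexx _))).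
have [u0 uv v0 E] := root6_step R n.
move: (root6 R n) (root6 R n.+1) u0 uv v0 E => u v u0 uv v0 E.
rewrite -lerBrDl -mulrBr exprVn -[X in X <= _]mul1r ler_pdivrMr ?exprn_gt0 //.
rewrite -subr_ge0.
have -> : 3 / 2 * (v ^+ 4 - u ^+ 4) * v ^+ 2 - 1 =
    (v ^+ 2 - u ^+ 2) ^+ 2 * (v ^+ 2 + 2 * u ^+ 2) / 2 + (v ^+ 6 - (u ^+ 6 + 1)).
  by field.
rewrite E subrr addr0; apply: divr_ge0 => //; apply: mulr_ge0; first exact: sqr_ge0.
by have := sqr_ge0 v; have := sqr_ge0 u; lra.
Qed.

Lemma sum_root6_N1 (R : rcfType) n :
  \sum_(1 <= j < n.+1) (root6 R j)^-1 <= 6 / 5 * root6 R n ^+ 5.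
Proof.
elim: n => [|n IH]; first by rewrite big_geq //; rewrite !mulr_ge0 ?invr_ge0 ?exprn_ge0 ?root6_ge0.
rewrite big_nat_recr //=; apply: (le_trans (lerD IH (lexx _))).
have [u0 uv v0 E] := root6_step R n.
move: (root6 R n) (root6 R n.+1) u0 uv v0 E => u v u0 uv v0 E.
rewrite -lerBrDl -mulrBr -[X in X <= _]mul1r ler_pdivrMr //.
rewrite -subr_ge0.
have -> : 6 / 5 * (v ^+ 5 - u ^+ 5) * v - 1 =
    (v - u) ^+ 2 * (v ^+ 4 + 2 * (v ^+ 3 * u) + 3 * (v ^+ 2 * u ^+ 2) + 4 * (v * u ^+ 3)
      + 5 * u ^+ 4) / 5 + (v ^+ 6 - (u ^+ 6 + 1)).
  by field.
have w0 := ltW v0.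
rewrite E subrr addr0; apply: divr_ge0 => //; apply: mulr_ge0; first exact: sqr_ge0.
by rewrite !(addr_ge0, mulr_ge0) ?exprn_ge0.
Qed.

Lemma sum_root6_N7 (R : rcfType) n : \sum_(1 <= j < n.+1) (root6 R j)^-1 ^+ 7 <= 7.
Proof.
case: n => [|n]; first by rewrite big_geq.
(* The subtracted term is the integral of [t^(-7/6)] from [n + 1] to infinity; it makes the
   induction close. *)
suff : \sum_(1 <= j < n.+2) (root6 R j)^-1 ^+ 7 <= 7 - 6 * (root6 R n.+1)^-1.
  move=> H; apply: le_trans H _; rewrite gerBl mulr_ge0 ?invr_ge0 ?root6_ge0 //.
elim: n => [|n IH]; first by rewrite big_nat1 root6_1 invr1 expr1n; lra.
rewrite big_nat_recr //=; apply: (le_trans (lerD IH (lexx _))).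
have [u0' uv v0 E] := root6_step R n.+1; have u0 := root6_gt0 R (ltn0Sn n).
move: (root6 R n.+1) (root6 R n.+2) u0 u0' uv v0 E => u v u0 u0' uv v0 E.
suff : 0 <= 6 * (u^-1 - v^-1) - v^-1 ^+ 7 by lra.
have -> : 6 * (u^-1 - v^-1) - v^-1 ^+ 7 = (6 * (v - u) * v ^+ 5 * v - u) / (u * v ^+ 7).
  by field; rewrite !gt_eqF.
have w0 := ltW v0.
rewrite divr_ge0 ?mulr_ge0 ?exprn_ge0 // subr_ge0.
apply: (le_trans uv); rewrite -[X in X <= _]mul1r ler_wpM2r //.
have E1 : v ^+ 6 - u ^+ 6 = 1 by rewrite E addrAC subrr add0r.
rewrite -[X in X <= _]E1.
have -> : v ^+ 6 - u ^+ 6 = (v - u) *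
  (v ^+ 5 + v ^+ 4 * u + v ^+ 3 * u ^+ 2 + v ^+ 2 * u ^+ 3 + v * u ^+ 4 + u ^+ 5) by ring.
have -> : 6 * (v - u) * v ^+ 5 = (v - u) * (6 * v ^+ 5) by ring.
rewrite ler_wpM2l ?subr_ge0 //.
have H i j : (i + j = 5)%N -> v ^+ i * u ^+ j <= v ^+ 5.
  move=> <-; rewrite exprD ler_wpM2l ?exprn_ge0 //.
  by rewrite lerXn2r ?nnegrE.
have := (H 4 1 erefl, H 3 2 erefl, H 2 3 erefl, H 1 4 erefl, H 0 5 erefl)%N.
by rewrite !expr1 expr0 mul1r => -[[[[? ?] ?] ?] ?]; lra.
Qed.

Lemma sum_root6_N8 (R : rcfType) n : \sum_(1 <= j < n.+1) (root6 R j)^-1 ^+ 8 <= 4.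
Proof.
case: n => [|n]; first by rewrite big_geq.
suff : \sum_(1 <= j < n.+2) (root6 R j)^-1 ^+ 8 <= 4 - 3 * (root6 R n.+1)^-1 ^+ 2.
  move=> H; apply: le_trans H _.
  by rewrite gerBl mulr_ge0 ?exprn_ge0 ?invr_ge0 ?root6_ge0.
elim: n => [|n IH]; first by rewrite big_nat1 root6_1 invr1 !expr1n; lra.
rewrite big_nat_recr //=; apply: (le_trans (lerD IH (lexx _))).
have [u0' uv v0 E] := root6_step R n.+1; have u0 := root6_gt0 R (ltn0Sn n).
move: (root6 R n.+1) (root6 R n.+2) u0 u0' uv v0 E => u v u0 u0' uv v0 E.
suff : 0 <= 3 * (u^-1 ^+ 2 - v^-1 ^+ 2) - v^-1 ^+ 8 by lra.
have -> : 3 * (u^-1 ^+ 2 - v^-1 ^+ 2) - v^-1 ^+ 8 =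
    (3 * (v ^+ 2 - u ^+ 2) * v ^+ 4 * v ^+ 2 - u ^+ 2) / (u ^+ 2 * v ^+ 8).
  by field; rewrite !gt_eqF.
have w0 := ltW v0.
have uv2 : u ^+ 2 <= v ^+ 2 by rewrite lerXn2r ?nnegrE.
rewrite divr_ge0 ?mulr_ge0 ?exprn_ge0 // subr_ge0.
apply: (le_trans uv2); rewrite -[X in X <= _]mul1r ler_wpM2r ?sqr_ge0 //.
have E1 : v ^+ 6 - u ^+ 6 = 1 by rewrite E addrAC subrr add0r.
rewrite -[X in X <= _]E1.
rewrite -subr_ge0.
have -> : 3 * (v ^+ 2 - u ^+ 2) * v ^+ 4 - (v ^+ 6 - u ^+ 6) =
   (v ^+ 2 - u ^+ 2) * (v ^+ 2 * (v ^+ 2 - u ^+ 2) + (v ^+ 2 - u ^+ 2) * (v ^+ 2 + u ^+ 2)) by ring.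
apply: mulr_ge0; first by rewrite subr_ge0.
by apply: addr_ge0; apply: mulr_ge0; rewrite ?subr_ge0 ?addr_ge0 ?sqr_ge0.
Qed.

(** * Counting the exceptional primes *)

Lemma sum_consecutive (R : rcfType) (g : nat -> nat) (t : nat -> R) n :
  (forall i, (g i <= g i.+1)%N) ->
  \sum_(0 <= i < n) \sum_(g i <= v < g i.+1) t v = \sum_(g 0%N <= v < g n) t v.
Proof.
move=> gS; elim: n => [|n IH]; first by rewrite !big_geq.
rewrite big_nat_recr //= IH -big_cat_nat //.
by elim: n {IH} => // n IH; apply: leq_trans IH _.
Qed.

(** [o] is the smaller variable, [v] the larger. For the summand 1, the range [v <= 4m/o] is cut
    into four blocks, since [N^(1/6)] will be bounded at the right end of each. The quotient
    [m %/ (o * v)] counts the [h >= 1] with [o h v <= m]; exchanging the sums leaves the intervals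
    [v <= m/(o h)], where [h <= m/o^2] because [o <= v]. *)
Lemma inner_sum_split (R : rcfType) (m o : nat) (P : pred nat) (t : nat -> R) :
  (0 < m)%N -> (0 < o)%N -> (forall v, 0 <= t v) -> (forall v, P v -> (o <= v)%N) ->
  \sum_(1 <= v < (4 * m).+1 | P v && (o * v <= 4 * m)%N) t v * (1 + (m %/ (o * v))%:R) <=
  \sum_(0 <= i < 4) \sum_((i * m %/ o).+1 <= v < (i.+1 * m %/ o).+1) t v +
  \sum_(1 <= h < (m %/ o ^ 2).+1) \sum_(1 <= v < (m %/ (o * h)).+1) t v.
Proof.
move=> m0 o0 t0 Po.
have -> : \sum_(1 <= v < (4 * m).+1 | P v && (o * v <= 4 * m)%N)
      t v * (1 + (m %/ (o * v))%:R) =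
    \sum_(1 <= v < (4 * m).+1 | P v && (o * v <= 4 * m)%N) t v +
    \sum_(1 <= v < (4 * m).+1 | P v && (o * v <= 4 * m)%N) t v * (m %/ (o * v))%:R.
  by rewrite -big_split; apply: eq_bigr => v _; rewrite mulrDr mulr1.
apply: lerD.
  have -> : \sum_(0 <= i < 4) \sum_((i * m %/ o).+1 <= v < (i.+1 * m %/ o).+1) t v =
      \sum_(1 <= v < (4 * m %/ o).+1) t v.
    rewrite (@sum_consecutive R (fun i => (i * m %/ o).+1) t 4) ?mul0n ?div0n // => i.
    by rewrite ltnS leq_div2r // leq_mul2r leqnSn orbT.
  have le4 : ((4 * m %/ o).+1 <= (4 * m).+1)%N by rewrite ltnS leq_div.
  rewrite [X in X <= _](@big_cat_nat _ _ _ (4 * m %/ o).+1) //=.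
  rewrite [X in _ + X]big_nat_cond [X in _ + X]big_pred0 ?addr0 => [|v]; last first.
    apply/negP => /andP[/andP[lt _] /andP[_]].
    by rewrite leqNgt [(o * v)%N]mulnC -ltn_divLR // lt.
  by rewrite big_mkcond; apply: ler_sum => v _; case: ifP.
rewrite big_nat_cond.
apply: (@le_trans _ _ (\sum_(1 <= v < (4 * m).+1 | (1 <= v < (4 * m).+1)%N && (P v && (o * v <= 4 * m)%N))
    \sum_(1 <= h < (m %/ o ^ 2).+1) (if (o * h * v <= m)%N then t v else 0))).
  apply: ler_sum => v /andP[/andP[v0 _] /andP[Pv _]].
  have ov0 : (0 < o * v)%N by rewrite muln_gt0 o0.
  have dv : (m %/ (o * v) <= m %/ o ^ 2)%N.
    by rewrite leq_div2l // ?expn_gt0 ?o0 // -mulnn leq_mul2l Po ?orbT.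
  rewrite (@big_cat_nat _ _ _ (m %/ (o * v)).+1) //= ler_wpDr //.
    by apply: sumr_ge0 => h _; case: ifP.
  rewrite (eq_big_nat _ _ (F2 := fun=> t v)) => [|h /andP[_ hm]].
    by rewrite big_const_nat iter_addr_0 subn1 mulr_natr.
  by rewrite mulnAC mulnC -leq_divRL // -ltnS hm.
rewrite exchange_big /=; apply: ler_sum_nat => h /andP[h0 _].
have oh0 : (0 < o * h)%N by rewrite muln_gt0 o0.
have le1 : ((m %/ (o * h)).+1 <= (4 * m).+1)%N.
  by rewrite ltnS (leq_trans (leq_div _ _)) // leq_pmull.
apply: (@le_trans _ _ (\sum_(1 <= v < (4 * m).+1) (if (o * h * v <= m)%N then t v else 0))).
  by rewrite big_mkcond; apply: ler_sum => v _; case: ifP => //; case: ifP.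
rewrite (@big_cat_nat _ _ _ (m %/ (o * h)).+1) //=.
rewrite [X in _ + X]big_nat_cond [X in _ + X]big1 ?addr0 => [|v /andP[/andP[v1 _] _]].
  by apply: ler_sum => v _; case: ifP.
by rewrite leqNgt mulnC -ltn_divLR // v1.
Qed.

(** [k v^2 = (k v)^2 / k] is at most [X^2 / (k h^2)]. The factor 1.001 absorbs the [+ 1], as
    [m k v^2 >= 200] and [1.001^6 >= 201/200]. *)
Lemma root6_quadratic_le (R : rcfType) m k v h X :
  (200 <= m)%N -> (0 < k)%N -> (0 < v)%N -> (0 < h)%N -> (k * v * h <= X)%N ->
  root6 R (m * k * v ^ 2 + 1) <=
    1001%:R / 1000%:R * root6 R m * root6 R X ^+ 2 * (root6 R k)^-1 * (root6 R h)^-1 ^+ 2.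
Proof.
move=> m200 k0 v0 h0 le.
have kp := root6_gt0 R k0; have hp := root6_gt0 R h0.
apply: ler_sixth; rewrite ?root6_ge0 //.
  by rewrite !(mulr_ge0, exprn_ge0, invr_ge0, root6_ge0).
have E (p q r s t : R) : (p * q * r ^+ 2 * s * t ^+ 2) ^+ 6 =
    p ^+ 6 * q ^+ 6 * (r ^+ 6) ^+ 2 * s ^+ 6 * (t ^+ 6) ^+ 2 by ring.
rewrite E !exprVn !root6X.
have kR : 0 < k%:R :> R by rewrite ltr0n.
have hR : 0 < h%:R ^+ 2 :> R by rewrite exprn_gt0 // ltr0n.
rewrite ler_pdivlMr // ler_pdivlMr //.
apply: (@le_trans _ _ ((1001%:R / 1000%:R) ^+ 6 * m%:R * (k * v * h)%:R ^+ 2)); last first.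
  apply: ler_wpM2l; first by rewrite mulr_ge0 // exprn_ge0 // divr_ge0.
  by rewrite lerXn2r ?nnegrE ?ler_nat.
have -> : (m * k * v ^ 2 + 1)%:R = m%:R * k%:R * v%:R ^+ 2 + 1 :> R.
  by rewrite natrD natrM natrX natrM.
rewrite !natrM.
have N1 : 200%:R <= m%:R * k%:R * v%:R ^+ 2 :> R.
  by rewrite -natrX -!natrM ler_nat (leq_trans m200) // -mulnA leq_pmulr // muln_gt0 k0 expn_gt0 v0.
have c6 : 201%:R / 200%:R <= (1001%:R / 1000%:R) ^+ 6 :> R by lra.
move: ((1001%:R / 1000%:R) ^+ 6) c6 => c c6.
rewrite -subr_ge0 (_ : _ - _ =
  (c * (m%:R * k%:R * v%:R ^+ 2) - (m%:R * k%:R * v%:R ^+ 2 + 1)) * (k%:R * h%:R ^+ 2)); last by ring.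
apply: mulr_ge0; last by rewrite mulr_ge0 ?ltW.
nra.
Qed.

Lemma root6_linear_le (R : rcfType) m a v h X :
  (200 <= m)%N -> (0 < a)%N -> (0 < v)%N -> (0 < h)%N -> (a * v * h <= X)%N ->
  root6 R (m * a ^ 2 * v + 1) <=
    1001%:R / 1000%:R * root6 R m * root6 R X * root6 R a * (root6 R h)^-1.
Proof.
move=> m200 a0 v0 h0 le.
have hp := root6_gt0 R h0.
apply: ler_sixth; rewrite ?root6_ge0 //.
  by rewrite !(mulr_ge0, exprn_ge0, invr_ge0, root6_ge0).
have E (p q r s t : R) : (p * q * r * s * t) ^+ 6 =
    p ^+ 6 * q ^+ 6 * r ^+ 6 * s ^+ 6 * t ^+ 6 by ring.
rewrite E !exprVn !root6X.
have hR : 0 < h%:R :> R by rewrite ltr0n.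
rewrite ler_pdivlMr //.
apply: (@le_trans _ _ ((1001%:R / 1000%:R) ^+ 6 * m%:R * (a * v * h)%:R * a%:R)); last first.
  apply: ler_wpM2r => //; apply: ler_wpM2l; last by rewrite ler_nat.
  by rewrite mulr_ge0 // exprn_ge0 // divr_ge0.
have -> : (m * a ^ 2 * v + 1)%:R = m%:R * a%:R ^+ 2 * v%:R + 1 :> R.
  by rewrite natrD natrM natrM natrX.
rewrite !natrM.
have N1 : 200%:R <= m%:R * a%:R ^+ 2 * v%:R :> R.
  by rewrite -natrX -!natrM ler_nat (leq_trans m200) // -mulnA leq_pmulr // muln_gt0 v0 expn_gt0 a0.
have c6 : 201%:R / 200%:R <= (1001%:R / 1000%:R) ^+ 6 :> R by lra.
move: ((1001%:R / 1000%:R) ^+ 6) c6 => c c6.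
rewrite -subr_ge0 (_ : _ - _ =
  (c * (m%:R * a%:R ^+ 2 * v%:R) - (m%:R * a%:R ^+ 2 * v%:R + 1)) * h%:R); last by ring.
apply: mulr_ge0; last by rewrite ltW.
nra.
Qed.

Lemma natr_divn_le (R : rcfType) m o : (0 < o)%N ->
  (m %/ o)%:R <= root6 R m ^+ 6 * (root6 R o)^-1 ^+ 6.
Proof.
move=> o0; rewrite exprVn !root6X ler_pdivlMr ?ltr0n // -natrM ler_nat.
exact: leq_trunc_div.
Qed.

Lemma root6_234_le (R : rcfType) :
  [/\ root6 R 2 <= 449%:R / 400%:R, root6 R 3 <= 1201%:R / 1000%:R &
      root6 R 4 <= 63%:R / 50%:R].
Proof. by split; apply: ler_sixth; rewrite ?root6_ge0 ?root6X //; lra. Qed.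

Lemma block_length_le (R : rcfType) i m o : (0 < o)%N ->
  (i.+1 * m %/ o - i * m %/ o)%:R <= root6 R m ^+ 6 * (root6 R o)^-1 ^+ 6 + 1.
Proof.
move=> o0; apply: le_trans (lerD (natr_divn_le R m o0) (lexx 1)).
rewrite natr1 ler_nat leq_subLR -ltnS ltn_divLR // mulSn.
have := ltn_ceil m o0; have := ltn_ceil (i * m) o0.
by rewrite !mulSn mulnDl mulSn; lia.
Qed.

Lemma interval_sum (R : rcfType) (nu : nat -> nat) (a b : nat) (B l : R) :
  (forall q, prime q -> exists2 rs : seq nat, (size rs <= (q != 2).+1)%N &
     forall x, (q %| nu x)%N -> has (fun r => x == r %[mod q])%N rs) ->
  (forall x, 0 < nu x)%N -> 0 <= B -> (a <= b)%N -> (b - a)%:R <= l ->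
  (forall x, (a < x <= b)%N -> root6 R (nu x) <= B) ->
  \sum_(a.+1 <= x < b.+1) (size (divisors (nu x)))%:R <=
    B * (4215%:R / 500%:R * l + 2007%:R).
Proof.
move=> roots nu0 B0 ab len nuB.
have -> : b.+1 = (a.+1 + (b - a))%N by rewrite addSn subnKC.
apply: le_trans (sum_size_divisors_interval roots nu0 B0 _) _ => [x|].
  by rewrite addSn subnKC // ltnS => ?; apply: nuB.
by rewrite ler_wpM2l // lerD2r ler_wpM2l // divr_ge0.
Qed.

(** [S] bounds [1 + 2^(1/3) + 3^(1/3) + 4^(1/3)], one term per block. The 4 added to it bounds the
    sum of [h^(-4/3)], and [3/2] comes from the sum of [h^(-1/3)] over [h <= m/k^2]. *)
Lemma region1_inner (R : rcfType) (m k : nat) (c G K S mu x : R) :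
  (200 <= m)%N -> (0 < k)%N -> c = 4215%:R / 500%:R -> G = 2007%:R ->
  K = 1001%:R / 1000%:R -> S = 2646%:R / 500%:R ->
  mu = root6 R m -> x = (root6 R k)^-1 ->
  \sum_(1 <= v < (4 * m).+1 | (k <= v)%N && (k * v <= 4 * m)%N)
     (size (divisors (m * k * v ^ 2 + 1)))%:R * (1 + (m %/ (k * v))%:R) <=
  K * ((S + 4) * c * mu ^+ 9 * x ^+ 7 + S * (c + G) * mu ^+ 3 * x + 3 / 2 * G * mu ^+ 7 * x ^+ 9).
Proof.
move=> m200 k0 Ec EG EK ES Emu Ex.
have m0 : (0 < m)%N by apply: leq_trans m200.
have mu0 : 0 < mu by rewrite Emu root6_gt0.
have x0 : 0 < x by rewrite Ex invr_gt0 root6_gt0.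
have x1 : 0 <= x by apply: ltW.
have mu1 : 0 <= mu by apply: ltW.
have c0 : 0 <= c by rewrite Ec divr_ge0.
have G0 : 0 <= G by rewrite EG.
have K0 : 0 <= K by rewrite EK divr_ge0.
apply: le_trans (inner_sum_split m0 k0 _ _) _ => //.
pose nu v := (m * k * v ^ 2 + 1)%N.
have nu0 v : (0 < nu v)%N by rewrite /nu addn1.
have roots := quadratic_roots (m * k).
have blocks : \sum_(0 <= i < 4) \sum_((i * m %/ k).+1 <= v < (i.+1 * m %/ k).+1)
    (size (divisors (nu v)))%:R <=
    K * (S * (c * mu ^+ 6 * x ^+ 6 + (c + G)) * mu ^+ 3 * x).
  pose l := mu ^+ 6 * x ^+ 6 + 1.
  apply: (@le_trans _ _ (\sum_(0 <= i < 4) K * mu ^+ 3 * x * (c * l + G) * root6 R i.+1 ^+ 2)).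
    apply: ler_sum => i _.
    have B0 : 0 <= K * mu * root6 R (i.+1 * m)%N ^+ 2 * x * (root6 R 1)^-1 ^+ 2.
      by rewrite !(mulr_ge0, exprn_ge0, invr_ge0, root6_ge0) //.
    apply: le_trans (interval_sum (l := l) roots nu0 B0 _ _ _) _.
    - by rewrite leq_div2r // leq_mul2r leqnSn orbT.
    - by rewrite /l Emu Ex; apply: block_length_le.
    - move=> v /andP[v1 v2]; rewrite EK Emu Ex; apply: root6_quadratic_le => //.
        exact: leq_ltn_trans v1.
      by rewrite muln1 mulnC -leq_divRL.
    rewrite root6_1 invr1 expr1n root6M -Emu -Ec -EG.
    by rewrite le_eqVlt; apply/orP; left; apply/eqP; ring.
  rewrite -mulr_sumr !big_nat_recr //= big_geq // root6_1.
  have [r2 r3 r4] := root6_234_le R.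
  have s (y z : R) : 0 <= y -> y <= z -> y ^+ 2 <= z ^+ 2.
    by move=> y0 yz; rewrite lerXn2r ?nnegrE // (le_trans y0).
  have := (s _ _ (root6_ge0 R _) r2, s _ _ (root6_ge0 R _) r3, s _ _ (root6_ge0 R _) r4).
  move=> -[[q2 q3] q4].
  have -> : K * (S * (c * mu ^+ 6 * x ^+ 6 + (c + G)) * mu ^+ 3 * x) =
     K * mu ^+ 3 * x * (c * l + G) * S by rewrite /l; ring.
  apply: ler_wpM2l; last by rewrite expr1n add0r ES; move: q2 q3 q4; clear; lra.
  have l0 : 0 <= l by rewrite /l addr_ge0 // mulr_ge0 ?exprn_ge0.
  by rewrite mulr_ge0 ?addr_ge0 ?(mulr_ge0 c0) // mulr_ge0 // mulr_ge0 ?exprn_ge0.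
have tails : \sum_(1 <= h < (m %/ k ^ 2).+1) \sum_(1 <= v < (m %/ (k * h)).+1)
    (size (divisors (nu v)))%:R <=
    K * (4 * c * mu ^+ 9 * x ^+ 7 + 3 / 2 * G * mu ^+ 7 * x ^+ 9).
  set H := (m %/ k ^ 2)%N.
  apply: (@le_trans _ _ (\sum_(1 <= h < H.+1)
      (K * c * mu ^+ 9 * x ^+ 7 * (root6 R h)^-1 ^+ 8 + K * G * mu ^+ 3 * x * (root6 R h)^-1 ^+ 2))).
    apply: ler_sum_nat => h /andP[h0 _].
    have kh0 : (0 < k * h)%N by rewrite muln_gt0 k0.
    have B0 : 0 <= K * mu * mu ^+ 2 * x * (root6 R h)^-1 ^+ 2.
      by rewrite !(mulr_ge0, exprn_ge0, invr_ge0, root6_ge0) //.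
    apply: le_trans (interval_sum (l := mu ^+ 6 * x ^+ 6 * (root6 R h)^-1 ^+ 6) roots nu0 B0 _ _ _) _.
    - by [].
    - rewrite subn0; apply: le_trans (natr_divn_le R m kh0) _.
      by rewrite root6M invfM exprMn mulrA Emu Ex.
    - move=> v /andP[v1 v2]; rewrite EK Emu Ex; apply: root6_quadratic_le => //.
      by rewrite mulnAC mulnC -leq_divRL.
    by rewrite le_eqVlt; apply/orP; left; apply/eqP; rewrite -Ec -EG; ring.
  rewrite big_split /= -!mulr_sumr mulrDr; apply: lerD.
    have := ler_wpM2l _ (sum_root6_N8 R H).
    move=> /(_ (K * c * mu ^+ 9 * x ^+ 7)) le; apply: le_trans (le _) _.
      by rewrite !(mulr_ge0, exprn_ge0) //.
    by rewrite le_eqVlt; apply/orP; left; apply/eqP; ring.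
  have H1 : root6 R H <= mu * x ^+ 2.
    rewrite Emu Ex exprVn ler_pdivlMr ?exprn_gt0 ?root6_gt0 // expr2 -!root6M.
    by apply: root6_le; rewrite mulnn leq_trunc_div.
  have H4 : root6 R H ^+ 4 <= (mu * x ^+ 2) ^+ 4.
    by rewrite lerXn2r ?nnegrE ?root6_ge0 // (le_trans (root6_ge0 R H)).
  have := ler_wpM2l _ (le_trans (sum_root6_N2 R H) (ler_wpM2l _ H4)).
  move=> /(_ (K * G * mu ^+ 3 * x)) le; apply: le_trans (le _ _) _.
  - by rewrite !(mulr_ge0, exprn_ge0) //.
  - by rewrite divr_ge0.
  by rewrite le_eqVlt; apply/orP; left; apply/eqP; ring.
apply: le_trans (lerD blocks tails) _.
by rewrite le_eqVlt; apply/orP; left; apply/eqP; ring.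
Qed.

(** The number whose divisors are counted is now linear in the larger variable: [S] bounds
    [1 + 2^(1/6) + 3^(1/6) + 4^(1/6)], and the 7 added to it bounds the sum of [h^(-7/6)]. *)
Lemma region2_inner (R : rcfType) (m a : nat) (c G K S mu x : R) :
  (200 <= m)%N -> (0 < a)%N -> c = 4215%:R / 500%:R -> G = 2007%:R ->
  K = 1001%:R / 1000%:R -> S = 2293%:R / 500%:R ->
  mu = root6 R m -> x = (root6 R a)^-1 ->
  \sum_(1 <= v < (4 * m).+1 | (a < v)%N && (a * v <= 4 * m)%N)
     (size (divisors (m * a ^ 2 * v + 1)))%:R * (1 + (m %/ (a * v))%:R) <=
  K * ((S + 7) * c * mu ^+ 8 * x ^+ 5 + S * (c + G) * mu ^+ 2 * root6 R a +
    6 / 5 * G * mu ^+ 7 * x ^+ 9).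
Proof.
move=> m200 a0 Ec EG EK ES Emu Ex.
have m0 : (0 < m)%N by apply: leq_trans m200.
have mu0 : 0 < mu by rewrite Emu root6_gt0.
have x0 : 0 < x by rewrite Ex invr_gt0 root6_gt0.
have x1 : 0 <= x by apply: ltW.
have mu1 : 0 <= mu by apply: ltW.
have [y [Ey y1 xy]] : exists y, [/\ y = root6 R a, 0 <= y & x * y = 1].
  by exists (root6 R a); rewrite root6_ge0 Ex mulVf // gt_eqF ?root6_gt0.
rewrite -Ey.
have xy6 : x ^+ 6 * y = x ^+ 5 by rewrite exprSr -mulrA xy mulr1.
have xy10 : x ^+ 10 * y = x ^+ 9 by rewrite exprSr -mulrA xy mulr1.
have c0 : 0 <= c by rewrite Ec divr_ge0.
have G0 : 0 <= G by rewrite EG.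
have K0 : 0 <= K by rewrite EK divr_ge0.
apply: le_trans (inner_sum_split m0 a0 _ _) _ => // [v /ltnW //|].
pose nu v := (m * a ^ 2 * v + 1)%N.
have nu0 v : (0 < nu v)%N by rewrite /nu addn1.
have roots := linear_roots (m * a ^ 2).
have blocks : \sum_(0 <= i < 4) \sum_((i * m %/ a).+1 <= v < (i.+1 * m %/ a).+1)
    (size (divisors (nu v)))%:R <=
    K * (S * (c * mu ^+ 6 * x ^+ 6 + (c + G)) * mu ^+ 2 * y).
  pose l := mu ^+ 6 * x ^+ 6 + 1.
  apply: (@le_trans _ _ (\sum_(0 <= i < 4) K * mu ^+ 2 * y * (c * l + G) * root6 R i.+1)).
    apply: ler_sum => i _.
    have B0 : 0 <= K * mu * root6 R (i.+1 * m)%N * y * (root6 R 1)^-1.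
      by rewrite !(mulr_ge0, exprn_ge0, invr_ge0, root6_ge0) //.
    apply: le_trans (interval_sum (l := l) roots nu0 B0 _ _ _) _.
    - by rewrite leq_div2r // leq_mul2r leqnSn orbT.
    - by rewrite /l Emu Ex; apply: block_length_le.
    - move=> v /andP[v1 v2]; rewrite EK Emu Ey; apply: root6_linear_le => //.
        exact: leq_ltn_trans v1.
      by rewrite muln1 mulnC -leq_divRL.
    rewrite root6_1 invr1 root6M -Emu -Ec -EG.
    by rewrite le_eqVlt; apply/orP; left; apply/eqP; ring.
  rewrite -mulr_sumr !big_nat_recr //= big_geq // root6_1.
  have [r2 r3 r4] := root6_234_le R.
  have -> : K * (S * (c * mu ^+ 6 * x ^+ 6 + (c + G)) * mu ^+ 2 * y) =
     K * mu ^+ 2 * y * (c * l + G) * S by rewrite /l; ring.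
  apply: ler_wpM2l; last by rewrite add0r ES; move: r2 r3 r4; clear; lra.
  have l0 : 0 <= l by rewrite /l addr_ge0 // mulr_ge0 ?exprn_ge0.
  by rewrite mulr_ge0 ?addr_ge0 ?(mulr_ge0 c0) // mulr_ge0 // mulr_ge0 ?exprn_ge0.
have tails : \sum_(1 <= h < (m %/ a ^ 2).+1) \sum_(1 <= v < (m %/ (a * h)).+1)
    (size (divisors (nu v)))%:R <=
    K * (7 * c * mu ^+ 8 * x ^+ 5 + 6 / 5 * G * mu ^+ 7 * x ^+ 9).
  set H := (m %/ a ^ 2)%N.
  apply: (@le_trans _ _ (\sum_(1 <= h < H.+1)
      (K * c * mu ^+ 8 * x ^+ 6 * y * (root6 R h)^-1 ^+ 7 + K * G * mu ^+ 2 * y * (root6 R h)^-1))).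
    apply: ler_sum_nat => h /andP[h0 _].
    have ah0 : (0 < a * h)%N by rewrite muln_gt0 a0.
    have B0 : 0 <= K * mu * mu * y * (root6 R h)^-1.
      by rewrite !(mulr_ge0, exprn_ge0, invr_ge0, root6_ge0) //.
    apply: le_trans (interval_sum (l := mu ^+ 6 * x ^+ 6 * (root6 R h)^-1 ^+ 6) roots nu0 B0 _ _ _) _.
    - by [].
    - rewrite subn0; apply: le_trans (natr_divn_le R m ah0) _.
      by rewrite root6M invfM exprMn mulrA Emu Ex.
    - move=> v /andP[v1 v2]; rewrite EK Emu Ey; apply: root6_linear_le => //.
      by rewrite mulnAC mulnC -leq_divRL.
    by rewrite le_eqVlt; apply/orP; left; apply/eqP; rewrite -Ec -EG; ring.
  rewrite big_split /= -!mulr_sumr mulrDr; apply: lerD.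
    have := ler_wpM2l _ (sum_root6_N7 R H).
    move=> /(_ (K * c * mu ^+ 8 * x ^+ 6 * y)) le; apply: le_trans (le _) _.
      by rewrite !(mulr_ge0, exprn_ge0) //.
    by rewrite le_eqVlt; apply/orP; left; apply/eqP; rewrite -xy6; ring.
  have H1 : root6 R H <= mu * x ^+ 2.
    rewrite Emu Ex exprVn ler_pdivlMr ?exprn_gt0 ?root6_gt0 // expr2 -!root6M.
    by apply: root6_le; rewrite mulnn leq_trunc_div.
  have H5 : root6 R H ^+ 5 <= (mu * x ^+ 2) ^+ 5.
    by rewrite lerXn2r ?nnegrE ?root6_ge0 // (le_trans (root6_ge0 R H)).
  have := ler_wpM2l _ (le_trans (sum_root6_N1 R H) (ler_wpM2l _ H5)).
  move=> /(_ (K * G * mu ^+ 2 * y)) le; apply: le_trans (le _ _) _.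
  - by rewrite !(mulr_ge0, exprn_ge0) //.
  - by rewrite divr_ge0.
  by rewrite le_eqVlt; apply/orP; left; apply/eqP; rewrite -xy10; ring.
apply: le_trans (lerD blocks tails) _.
by rewrite le_eqVlt; apply/orP; left; apply/eqP; rewrite -xy6; ring.
Qed.

Lemma nat_sqrt_exists n : exists s : nat, (s ^ 2 <= n < s.+1 ^ 2)%N.
Proof.
elim: n => [|n [s /andP[s1 s2]]]; first by exists 0%N.
have [lt|ge] := ltnP n.+1 (s.+1 ^ 2); first by exists s; rewrite lt (leq_trans s1).
exists s.+1; rewrite ge /=; apply: leq_ltn_trans s2 _.
by rewrite ltn_exp2r.
Qed.

Lemma sum_truncate_le (R : rcfType) (A N : nat) (f g : nat -> R) :
  (A <= N)%N -> (forall k, (0 < k <= A)%N -> f k <= g k) ->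
  (forall k, (A < k)%N -> f k = 0) ->
  \sum_(1 <= k < N.+1) f k <= \sum_(1 <= k < A.+1) g k.
Proof.
move=> AN fg f0; rewrite (@big_cat_nat _ _ _ A.+1) //=.
rewrite [X in _ + X]big_nat_cond [X in _ + X]big1 ?addr0 => [|k /andP[/andP[/f0]]//].
by apply: ler_sum_nat => k kA; apply: fg; rewrite -ltnS.
Qed.

(** The outer sum stops at [A], the integer square root of [4m], because [k^2 <= k v <= 4m]. In the
    last term [x^9] is relaxed to [x^8], whose sum is at most 4. *)
Lemma region1_sum (R : rcfType) (m A : nat) (c G K S mu : R) :
  (200 <= m)%N -> (A ^ 2 <= 4 * m < A.+1 ^ 2)%N ->
  c = 4215%:R / 500%:R -> G = 2007%:R -> K = 1001%:R / 1000%:R -> S = 2646%:R / 500%:R ->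
  mu = root6 R m ->
  \sum_(1 <= k < (4 * m).+1) \sum_(1 <= v < (4 * m).+1 | (k <= v)%N && (k * v <= 4 * m)%N)
     (size (divisors (m * k * v ^ 2 + 1)))%:R * (1 + (m %/ (k * v))%:R) <=
  K * ((S + 4) * c * mu ^+ 9 * 7 + S * (c + G) * mu ^+ 3 * A%:R + 6 * G * mu ^+ 7).
Proof.
move=> m200 /andP[A1 A2] Ec EG EK ES Emu.
have AN : (A <= 4 * m)%N by apply: leq_trans A1; rewrite -mulnn; case: (A) => // a; rewrite leq_pmull.
have K0 : 0 <= K by rewrite EK divr_ge0.
have G0 : 0 <= G by rewrite EG.
have c0 : 0 <= c by rewrite Ec divr_ge0.
have S0 : 0 <= S by rewrite ES divr_ge0.
have mu0 : 0 <= mu by rewrite Emu root6_ge0.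
pose g k := K * ((S + 4) * c * mu ^+ 9 * (root6 R k)^-1 ^+ 7 +
  S * (c + G) * mu ^+ 3 + 3 / 2 * G * mu ^+ 7 * (root6 R k)^-1 ^+ 8).
apply: (@le_trans _ _ (\sum_(1 <= k < A.+1) g k)).
  apply: sum_truncate_le => // [k /andP[k0 _]|k Ak]; last first.
    rewrite big1 // => v /andP[kv le]; suff B : (A.+1 ^ 2 <= 4 * m)%N.
      by have := leq_trans A2 B; rewrite ltnn.
    by apply: leq_trans le; rewrite -mulnn leq_mul // (leq_trans Ak).
  apply: le_trans (region1_inner m200 k0 Ec EG EK ES Emu erefl) _.
  have x0 : 0 <= (root6 R k)^-1 by rewrite invr_ge0 root6_ge0.
  have x1 : (root6 R k)^-1 <= 1 by rewrite invf_le1 ?root6_gt0 ?root6_ge1.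
  rewrite /g; move: ((root6 R k)^-1) x0 x1 => x x0 x1.
  apply: ler_wpM2l => //; apply: lerD; first apply: lerD => //.
    by rewrite ler_piMr // !mulr_ge0 ?exprn_ge0 ?addr_ge0.
  apply: ler_wpM2l; first by rewrite !mulr_ge0 ?exprn_ge0 ?invr_ge0.
  by rewrite exprSr ler_piMr ?exprn_ge0.
rewrite /g -mulr_sumr ler_wpM2l // !big_split /= -!mulr_sumr.
apply: lerD; first apply: lerD.
- by apply: ler_wpM2l (sum_root6_N7 R A); rewrite !mulr_ge0 ?exprn_ge0 ?addr_ge0.
- rewrite sumr_const_nat subn1 -[_ *+ A.+1.-1]mulr_natr.
  by rewrite le_eqVlt; apply/orP; left; apply/eqP; rewrite /=; ring.
apply: le_trans (ler_wpM2l _ (sum_root6_N8 R A)) _.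
  by rewrite !mulr_ge0 ?exprn_ge0 ?invr_ge0.
by rewrite le_eqVlt; apply/orP; left; apply/eqP; field.
Qed.

Lemma region2_sum (R : rcfType) (m A : nat) (c G K S mu : R) :
  (200 <= m)%N -> (A ^ 2 <= 4 * m < A.+1 ^ 2)%N ->
  c = 4215%:R / 500%:R -> G = 2007%:R -> K = 1001%:R / 1000%:R -> S = 2293%:R / 500%:R ->
  mu = root6 R m ->
  \sum_(1 <= a < (4 * m).+1) \sum_(1 <= v < (4 * m).+1 | (a < v)%N && (a * v <= 4 * m)%N)
     (size (divisors (m * a ^ 2 * v + 1)))%:R * (1 + (m %/ (a * v))%:R) <=
  K * ((S + 7) * c * mu ^+ 8 * (6 * root6 R A) +
       S * (c + G) * mu ^+ 2 * root6 R A * A%:R + 24 / 5 * G * mu ^+ 7).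
Proof.
move=> m200 /andP[A1 A2] Ec EG EK ES Emu.
have AN : (A <= 4 * m)%N by apply: leq_trans A1; rewrite -mulnn; case: (A) => // a; rewrite leq_pmull.
have K0 : 0 <= K by rewrite EK divr_ge0.
have G0 : 0 <= G by rewrite EG.
have c0 : 0 <= c by rewrite Ec divr_ge0.
have S0 : 0 <= S by rewrite ES divr_ge0.
have mu0 : 0 <= mu by rewrite Emu root6_ge0.
pose g a := K * ((S + 7) * c * mu ^+ 8 * (root6 R a)^-1 ^+ 5 +
  S * (c + G) * mu ^+ 2 * root6 R A + 6 / 5 * G * mu ^+ 7 * (root6 R a)^-1 ^+ 8).
apply: (@le_trans _ _ (\sum_(1 <= a < A.+1) g a)).
  apply: sum_truncate_le => // [a /andP[a0 aA]|a Aa]; last first.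
    rewrite big1 // => v /andP[/ltnW av le]; suff B : (A.+1 ^ 2 <= 4 * m)%N.
      by have := leq_trans A2 B; rewrite ltnn.
    by apply: leq_trans le; rewrite -mulnn leq_mul // (leq_trans Aa).
  apply: le_trans (region2_inner m200 a0 Ec EG EK ES Emu erefl) _.
  have x0 : 0 <= (root6 R a)^-1 by rewrite invr_ge0 root6_ge0.
  have x1 : (root6 R a)^-1 <= 1 by rewrite invf_le1 ?root6_gt0 ?root6_ge1.
  have y1 := root6_le R aA.
  rewrite /g.
  apply: ler_wpM2l => //; apply: lerD; first apply: lerD => //.
    by apply: ler_wpM2l y1; rewrite !mulr_ge0 ?exprn_ge0 ?addr_ge0.
  apply: ler_wpM2l; first by rewrite !mulr_ge0 ?exprn_ge0 ?invr_ge0.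
  by rewrite exprSr ler_piMr ?exprn_ge0.
rewrite /g -mulr_sumr ler_wpM2l // !big_split /= -!mulr_sumr.
apply: lerD; first apply: lerD.
- by apply: ler_wpM2l (sum_root6_N5 R A); rewrite !mulr_ge0 ?exprn_ge0 ?addr_ge0.
- rewrite sumr_const_nat subn1 -[_ *+ A.+1.-1]mulr_natr.
  by rewrite le_eqVlt; apply/orP; left; apply/eqP; rewrite /=; ring.
apply: le_trans (ler_wpM2l _ (sum_root6_N8 R A)) _.
  by rewrite !mulr_ge0 ?exprn_ge0 ?invr_ge0.
by rewrite le_eqVlt; apply/orP; left; apply/eqP; field.
Qed.

Lemma type1_sum_le (R : rcfType) (m : nat) (mu : R) :
  (200 <= m)%N -> mu = root6 R m -> 432%:R / 10%:R <= mu ->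
  \sum_(1 <= k < (4 * m).+1) \sum_(1 <= a < (4 * m).+1 | (k * a <= 4 * m)%N)
     (size (divisors (m * k * a ^ 2 + 1)))%:R * (1 + (m %/ (k * a))%:R) <=
  680%:R * mu ^+ 9.
Proof.
move=> m200 Emu mu43.
have [A AA] := nat_sqrt_exists (4 * m).
have R1 := region1_sum m200 AA erefl erefl erefl erefl Emu.
have R2 := region2_sum m200 AA erefl erefl erefl erefl Emu.
pose F k a : R := (size (divisors (m * k * a ^ 2 + 1)))%:R * (1 + (m %/ (k * a))%:R).
(* The pairs are split by [k <= a] or [a < k], and the second sum is exchanged so that the smaller
   variable is always outside. *)
have -> : \sum_(1 <= k < (4 * m).+1) \sum_(1 <= a < (4 * m).+1 | (k * a <= 4 * m)%N) F k a =
  \sum_(1 <= k < (4 * m).+1) \sum_(1 <= a < (4 * m).+1 | (k <= a)%N && (k * a <= 4 * m)%N) F k a +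
  \sum_(1 <= a < (4 * m).+1) \sum_(1 <= k < (4 * m).+1 | (a < k)%N && (a * k <= 4 * m)%N)
     (size (divisors (m * a ^ 2 * k + 1)))%:R * (1 + (m %/ (a * k))%:R).
  have -> : \sum_(1 <= a < (4 * m).+1)
     \sum_(1 <= k < (4 * m).+1 | (a < k)%N && (a * k <= 4 * m)%N)
     (size (divisors (m * a ^ 2 * k + 1)))%:R * (1 + (m %/ (a * k))%:R) =
     \sum_(1 <= k < (4 * m).+1) \sum_(1 <= a < (4 * m).+1 | (a < k)%N && (k * a <= 4 * m)%N) F k a.
    under eq_bigr do rewrite big_mkcond.
    rewrite exchange_big /=; apply: eq_bigr => k _; rewrite [RHS]big_mkcond.
    by apply: eq_bigr => a _; rewrite [(a * k)%N]mulnC /F [(m * k * _)%N]mulnAC.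
  rewrite -big_split; apply: eq_bigr => k _.
  rewrite (bigID (fun a => k <= a)%N) /=; congr (_ + _); apply: eq_bigl => a.
    by rewrite andbC.
  by rewrite andbC -ltnNge.
apply: le_trans (lerD R1 R2) _; clear R1 R2 F.
have mu0 : 0 <= mu by apply: le_trans mu43; rewrite divr_ge0.
have {AA}A2 : (A ^ 2 <= 4 * m)%N by case/andP: AA.
have E6 : mu ^+ 6 = m%:R by rewrite Emu root6X.
have HA : A%:R <= 2 * mu ^+ 3.
  rewrite -(@ler_pXn2r _ 2) ?nnegrE // ?mulr_ge0 ?exprn_ge0 //.
  by rewrite exprMn -exprM E6 -!natrX -natrM ler_nat.
(* [A^(1/6)] has order [mu^(1/2)]; the threshold makes it a small multiple of [mu], since
   [0.171^2 * 43.2 >= 1.26 >= 4^(1/6)]. *)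
have HX : root6 R A <= 171%:R / 1000%:R * mu.
  rewrite -(@ler_pXn2r _ 2) ?nnegrE ?root6_ge0 // ?mulr_ge0 ?invr_ge0 //.
  apply: (@le_trans _ _ (63%:R / 50%:R * mu)).
    have [_ _ r4] := root6_234_le R.
    apply: (@le_trans _ _ (root6 R 4 * mu)); last by rewrite ler_wpM2r.
    by rewrite Emu expr2 -!root6M root6_le.
  rewrite exprMn expr2 mulrA ler_wpM2r //; lra.
move: (A%:R : R) (root6 R A) HA HX (ler0n R A) (root6_ge0 R A) => a x HA HX a0 x0.
clear -mu0 mu43 HA HX a0 x0.
(* [43.2^2 = 1866.24]; this and the next line absorb the lower powers into [mu^9]. *)
have H7 : 1866%:R * mu ^+ 7 <= mu ^+ 9.
  rewrite (exprD _ 2 7) ler_wpM2r ?exprn_ge0 // expr2; nra.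
have H6 : 43%:R * mu ^+ 6 <= mu ^+ 7 by rewrite [mu ^+ 7]exprS ler_wpM2r ?exprn_ge0 //; lra.
have p6 : 0 <= mu ^+ 6 by apply: exprn_ge0.
have Q1 : mu ^+ 3 * a <= 2 * mu ^+ 6.
  have := ler_wpM2l (exprn_ge0 3 mu0) HA; rewrite mulrCA -exprD; lra.
have Q2 : mu ^+ 8 * x <= 171%:R / 1000%:R * mu ^+ 9.
  have := ler_wpM2l (exprn_ge0 8 mu0) HX; rewrite mulrCA -exprSr; lra.
have Q3 : mu ^+ 2 * x * a <= 342%:R / 1000%:R * mu ^+ 6.
  have := ler_wpM2l (exprn_ge0 2 mu0) (ler_pM x0 a0 HX HA).
  have -> : mu ^+ 2 * (171%:R / 1000%:R * mu * (2 * mu ^+ 3)) = 342%:R / 1000%:R * mu ^+ 6.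
    by field.
  by rewrite mulrA.
rewrite -![_ * mu ^+ 3 * a]mulrA.
move: (mu ^+ 9) (mu ^+ 7) (mu ^+ 6) H7 H6 p6 Q1 Q2 Q3 => m9 m7 m6 H7 H6 p6 Q1 Q2 Q3.
lra.
Qed.

(** * Lists that contain the exceptional primes *)

Lemma size_flatten_map (T : Type) (U : Type) (F : T -> seq U) (s : seq T) :
  size (flatten [seq F x | x <- s]) = (\sum_(x <- s) size (F x))%N.
Proof. by rewrite size_flatten /shape -map_comp sumnE big_map. Qed.

(** Multiples of [m d] are [m d] apart and the window has length [m^2], so the admissible [h] lie
    within [m/d] of the first one, [h0]. *)
Lemma size_window_le (m d u H : nat) : (0 < m)%N -> (0 < d)%N ->
  (size [seq h <- index_iota 1 H | u < m * d * h < u + m ^ 2] <= 1 + m %/ d)%N.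
Proof.
move=> m0 d0; have md0 : (0 < m * d)%N by rewrite muln_gt0 m0.
set h0 := (u %/ (m * d)).+1.
rewrite -[X in (_ <= X)%N](size_iota h0).
apply: uniq_leq_size; first by rewrite filter_uniq ?iota_uniq.
move=> h; rewrite mem_filter mem_iota => /andP[/andP[uh hu] _].
have h0h : (h0 <= h)%N by rewrite /h0 ltn_divLR // mulnC.
have h0u : (u < m * d * h0)%N by rewrite mulnC ltn_ceil.
suff : (h - h0 <= m %/ d)%N by rewrite h0h /=; lia.
rewrite leq_divRL // -(leq_pmul2l m0).
have -> : (m * ((h - h0) * d) = m * d * h - m * d * h0)%N by rewrite -mulnBr mulnA mulnAC.
rewrite leq_subLR mulnn; lia.
Qed.

(** The condition on [h] expresses [m^2 < m k a h - f < 2 m^2] without truncated subtraction. *)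
Definition type1_fiber (m k a : nat) : seq nat :=
  flatten [seq [seq (m * k * a * h - f)%N | h <- [seq h <- index_iota 1 (4 * m).+1 |
    (m ^ 2 + f < m * (k * a) * h < m ^ 2 + f + m ^ 2)%N]] |
    f <- divisors (m * k * a ^ 2 + 1)].

Lemma size_type1_fiber (m k a : nat) : (0 < m)%N -> (0 < k * a)%N ->
  (size (type1_fiber m k a) <=
   size (divisors (m * k * a ^ 2 + 1)) * (1 + m %/ (k * a)))%N.
Proof.
move=> m0 ka0; rewrite size_flatten_map.
apply: (@leq_trans (\sum_(f <- divisors (m * k * a ^ 2 + 1)) (1 + m %/ (k * a)))%N).
  by apply: leq_sum => f _; rewrite size_map; apply: size_window_le.
by rewrite big_const_seq iter_addn_0 count_predT mulnC.
Qed.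

Definition type1_values (m : nat) : seq nat :=
  flatten [seq flatten [seq type1_fiber m k a |
    a <- [seq a <- index_iota 1 (4 * m).+1 | (k * a <= 4 * m)%N]] |
    k <- index_iota 1 (4 * m).+1].

Lemma mem_type1_values (m p k a h f : nat) :
  (m ^ 2 < p)%N -> (p < 2 * m ^ 2)%N -> [/\ 0 < k, 0 < a & 0 < h]%N ->
  (f %| m * k * a ^ 2 + 1)%N -> (p + f = m * k * a * h)%N -> (k * a * h <= 4 * m)%N ->
  p \in type1_values m.
Proof.
move=> mp pm [k0 a0 h0] fN E le.
have ka : (k * a <= 4 * m)%N by apply: leq_trans le; rewrite leq_pmulr.
apply/flatten_mapP; exists k.
  by rewrite mem_index_iota k0 ltnS (leq_trans _ ka) // leq_pmulr.
apply/flatten_mapP; exists a.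
  by rewrite mem_filter ka mem_index_iota a0 ltnS (leq_trans _ ka) // leq_pmull.
apply/flatten_mapP; exists f; first by rewrite -dvdn_divisors // addn1.
apply/mapP; exists h; last by rewrite -E addnK.
rewrite mem_filter mem_index_iota h0 ltnS (leq_trans _ le) ?leq_pmull ?muln_gt0 ?k0 //.
by rewrite !mulnA -E andbT; apply/andP; split; lia.
Qed.

Lemma size_type1_values (R : rcfType) (m : nat) (mu : R) :
  (200 <= m)%N -> mu = root6 R m -> 432%:R / 10%:R <= mu ->
  (size (type1_values m))%:R <= 680%:R * mu ^+ 9.
Proof.
move=> m200 Emu mu43; apply: le_trans (type1_sum_le m200 Emu mu43).
rewrite size_flatten_map natr_sum; apply: ler_sum_nat => k /andP[k0 _].
rewrite size_flatten_map big_filter natr_sum big_nat_cond [X in _ <= X]big_nat_cond.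
apply: ler_sum => a /andP[/andP[a0 _] _].
rewrite -[1]/(1%:R) -natrD -natrM ler_nat size_type1_fiber ?muln_gt0 ?k0 //.
exact: leq_trans m200.
Qed.

Definition type2_values (m : nat) : seq nat :=
  flatten [seq flatten [seq flatten [seq
    [seq (m * k * a * (g * e - a) - e)%N |
      e <- [seq e <- index_iota 1 (4 * m + 4).+1 | (k * a * g * e <= 4 * m + 4)%N]] |
    g <- index_iota 1 (4 * m + 4).+1] | a <- index_iota 1 (4 * m + 4).+1] |
    k <- index_iota 1 (4 * m + 4).+1].

Lemma mem_type2_values (m p k a g e : nat) :
  [/\ 0 < k, 0 < a, 0 < g & 0 < e]%N ->
  (p + e = m * k * a * (g * e - a))%N -> (k * a * g * e <= 4 * m + 4)%N ->
  p \in type2_values m.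
Proof.
move=> [k0 a0 g0 e0] E le.
have le1 x y : (0 < y)%N -> (x * y <= 4 * m + 4)%N -> (x <= 4 * m + 4)%N.
  by move=> y0; apply: leq_trans; rewrite leq_pmulr.
have le2 x y : (0 < x)%N -> (x * y <= 4 * m + 4)%N -> (y <= 4 * m + 4)%N.
  by move=> x0; apply: leq_trans; rewrite leq_pmull.
have leg := le1 _ _ e0 le; have lea := le1 _ _ g0 leg.
apply/flatten_mapP; exists k; first by rewrite mem_index_iota k0 ltnS (le1 _ _ a0).
apply/flatten_mapP; exists a; first by rewrite mem_index_iota a0 ltnS (le2 _ _ k0).
apply/flatten_mapP; exists g.
  by rewrite mem_index_iota g0 ltnS (le2 (k * a)%N) // muln_gt0 k0.
apply/mapP; exists e; last by rewrite -E addnK.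
by rewrite mem_filter le mem_index_iota e0 ltnS (le2 (k * a * g)%N) // !muln_gt0 k0 a0.
Qed.

(* Rankin's trick: the indicator of [n <= Y] is at most [(Y / n) ^ (7 / 6)]. *)
Lemma size_type2_values (R : rcfType) (m : nat) (mu : R) :
  (200 <= m)%N -> mu = root6 R m -> 432%:R / 10%:R <= mu ->
  (size (type2_values m))%:R <= 9 * mu ^+ 9.
Proof.
move=> m200 Emu mu43; set Y := (4 * m + 4)%N.
pose x j := (root6 R j)^-1 ^+ 7.
have x0 j : 0 <= x j by rewrite exprn_ge0 // invr_ge0 root6_ge0.
have S (C : R) : 0 <= C -> \sum_(1 <= j < Y.+1) C * x j <= 7 * C.
  by move=> C0; rewrite -mulr_sumr mulrC ler_wpM2r // sum_root6_N7.
pose y := root6 R Y ^+ 7; have y0 : 0 <= y by rewrite exprn_ge0 // root6_ge0.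
apply: (@le_trans _ _ (7 * (7 * (7 * (7 * y))))).
  have S7 (z : R) : 0 <= z -> 0 <= 7 * z by move=> z0; rewrite mulr_ge0.
  rewrite size_flatten_map natr_sum.
  apply: le_trans (S _ (S7 _ (S7 _ (S7 _ y0)))); apply: ler_sum_nat => k /andP[k0 _].
  rewrite size_flatten_map natr_sum.
  have yk : 0 <= y * x k by rewrite mulr_ge0.
  apply: (@le_trans _ _ (7 * (7 * (7 * (y * x k))))); last first.
    by rewrite le_eqVlt; apply/orP; left; apply/eqP; ring.
  apply: le_trans (S _ (S7 _ (S7 _ yk))); apply: ler_sum_nat => a /andP[a0 _].
  rewrite size_flatten_map natr_sum.
  have ya : 0 <= y * x k * x a by rewrite mulr_ge0.
  apply: (@le_trans _ _ (7 * (7 * (y * x k * x a)))); last first.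
    by rewrite le_eqVlt; apply/orP; left; apply/eqP; ring.
  apply: le_trans (S _ (S7 _ ya)); apply: ler_sum_nat => g /andP[g0 _].
  have yg : 0 <= y * x k * x a * x g by rewrite mulr_ge0.
  apply: (@le_trans _ _ (7 * (y * x k * x a * x g))); last first.
    by rewrite le_eqVlt; apply/orP; left; apply/eqP; ring.
  apply: le_trans (S _ yg).
  rewrite size_map size_filter -sum1_count big_mkcond natr_sum.
  apply: ler_sum_nat => e /andP[e0 _].
  case: ifP => le; last by rewrite mulr_ge0.
  rewrite /y /x -!exprMn exprn_ege1 // -!mulrA -!invfM -!root6M.
  rewrite ler_pdivlMr ?root6_gt0 ?muln_gt0 ?k0 ?a0 ?g0 // mul1r.
  by apply: root6_le; rewrite !mulnA.
have mu0 : 0 <= mu by apply: le_trans mu43; rewrite divr_ge0.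
have ymu : root6 R Y <= 13%:R / 10%:R * mu.
  apply: ler_sixth; rewrite ?root6_ge0 ?mulr_ge0 ?invr_ge0 //.
  rewrite exprMn Emu !root6X natrD natrM.
  have : 200%:R <= m%:R :> R by rewrite ler_nat.
  clear; lra.
have y7 : y <= (13%:R / 10%:R * mu) ^+ 7.
  by rewrite lerXn2r ?nnegrE ?root6_ge0 // (le_trans (root6_ge0 R Y)).
have H7 : 1866%:R * mu ^+ 7 <= mu ^+ 9.
  rewrite (exprD _ 2 7) ler_wpM2r ?exprn_ge0 // expr2; clear -mu43; nra.
have p7 : 0 <= mu ^+ 7 by apply: exprn_ge0.
(* [7^4 * 1.3^7] is about 15066, and 15066/1866 is below 9. *)
rewrite exprMn in y7; move: (mu ^+ 9) (mu ^+ 7) y7 H7 p7 => m9 m7; clear; lra.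
Qed.

(** * Comparison with the number of primes *)

Lemma linear_le_exp2_quarter (R : rcfType) (j : nat) :
  (1040%:R * (j + 68)%:R) ^+ 4 <= 2 ^+ (j + 66) :> R.
Proof.
(* The base case is [70720^4 <= 2^66]; a step multiplies the left side by at most
   [(69/68)^4 < 2]. *)
elim: j => [|j IH]; first by rewrite !add0n; lra.
rewrite !addSn [X in _ <= X]exprS; apply: le_trans (ler_wpM2l _ IH) => //.
have : 68%:R <= (j + 68)%:R :> R by rewrite ler_nat leq_addl.
rewrite -[(j + 68).+1%:R]natr1; move: ((j + 68)%:R : R) => w w68.
have H : (1040%:R * (w + 1)) ^+ 4 <= (1040%:R * (69%:R / 68%:R * w)) ^+ 4.
  by rewrite lerXn2r ?nnegrE //; lra.
apply: (le_trans H).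
have -> : (1040%:R * (69%:R / 68%:R * w)) ^+ 4 =
  (69%:R / 68%:R) ^+ 4 * (1040%:R * w) ^+ 4 by field.
rewrite ler_wpM2r ?exprn_ge0 ?mulr_ge0 //; lra.
Qed.

(** [2^l < 4 mu^12] means [mu^3 > 2^((l - 2)/4)], which dominates [1040 l] from [l = 68] on; for
    [l <= 67] the threshold suffices, as [43.2^3 > 80000 > 1040 * 67]. *)
Lemma log_le_cube (R : rcfType) (m l : nat) (mu : R) :
  mu = root6 R m -> 432%:R / 10%:R <= mu -> (2 ^ l < 4 * m ^ 2)%N ->
  1040%:R * l%:R <= mu ^+ 3.
Proof.
move=> Emu mu43 lt.
have mu0 : 0 <= mu by apply: le_trans mu43; rewrite divr_ge0.
have [l67|l68] := leqP l 67.
  have : l%:R <= 67%:R :> R by rewrite ler_nat.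
  have : (432%:R / 10%:R) ^+ 3 <= mu ^+ 3.
    by rewrite lerXn2r ?nnegrE // divr_ge0.
  move: (mu ^+ 3) (l%:R : R) => u v; clear; lra.
have El : l = ((l - 68) + 68)%N by rewrite subnK.
rewrite -(@ler_pXn2r _ 4) ?nnegrE ?mulr_ge0 ?exprn_ge0 // El.
apply: le_trans (linear_le_exp2_quarter R (l - 68)) _.
rewrite -exprM (exprM mu 6 2) Emu root6X -!natrX ler_nat.
move: lt; rewrite {1}El !addnS !expnS; lia.
Qed.

(** If [s] contained all these primes, then [2 mu^12 <= 3 l * 690 mu^9], where 690 leaves [mu^9] of
    room for the small primes. With [1040 l <= mu^3] this is absurd, as
    [3 * 690 = 2070 < 2080 = 2 * 1040]. *)
Lemma exists_prime_notin (R : rcfType) (m : nat) (s : seq nat) (mu : R) :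
  (200 <= m)%N -> mu = root6 R m -> 432%:R / 10%:R <= mu ->
  (size s)%:R <= 689%:R * mu ^+ 9 ->
  exists p, [/\ prime p, (m ^ 2 < p)%N, (p < 2 * m ^ 2)%N & p \notin s].
Proof.
move=> m200 Emu mu43 sz.
set ps := index_iota (m ^ 2).+1 (2 * m ^ 2).
have [/hasP[p]|/hasPn none] := boolP (has (fun p => prime p && (p \notin s)) ps).
  by rewrite mem_index_iota => /andP[mp pm] /andP[pp psN]; exists p.
exfalso.
have cnt : (count prime ps <= size s)%N.
  rewrite -size_filter; apply: uniq_leq_size; first by rewrite filter_uniq ?iota_uniq.
  move=> p; rewrite mem_filter => /andP[pp pin].
  by have := none p pin; rewrite pp /= negbK.
set n := (m ^ 2)%N in ps cnt none *.
have n200 : (200 <= n)%N by rewrite /n -mulnn; apply: (leq_trans m200); rewrite leq_pmulr // (leq_trans _ m200).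
have [t /andP[t1 t2]] := nat_sqrt_exists n.*2.
have n0 : (0 < n)%N by apply: leq_trans n200.
have n20 : (1 < n.*2)%N by rewrite -addnn; lia.
have tm : (2 * t <= 3 * m)%N.
  rewrite -(@leq_exp2r _ _ 2) // !expnMn; move: t1; rewrite /n -mul2n; lia.
have tn : (t.*2 <= n)%N.
  rewrite -mul2n (leq_trans tm) // /n -mulnn leq_mul2r; apply/orP; right.
  by apply: leq_trans m200.
have n2 : (2 < n)%N by apply: leq_trans n200.
have C := leq_exp4_primes n2 t2 tn.
have /andP[l1 l2] := up_log_bounds (isT : 1 < 2)%N n20.
set l := up_log 2 n.*2 in l1 l2.
have l0 : (0 < l)%N by rewrite lt0n; apply/eqP => E; move: l2; rewrite E leqNgt n20.
have lle : 1040%:R * l%:R <= mu ^+ 3.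
  have E2 : (2 ^ l = 2 * 2 ^ l.-1)%N by rewrite -expnS prednK.
  apply: (log_le_cube Emu mu43); rewrite E2; move: l1; rewrite /n -mul2n; lia.
set q := count prime _ in C.
(* This is [C] in base-two logarithms, using [2n <= 2^l]. *)
have E : (2 * n <= l * (q + t + 1) + 2 * (n.*2 %/ 3))%N.
  rewrite -(@leq_exp2l 2) // expnD 2!expnM; apply: (leq_trans C).
  by rewrite expnM leq_mul2r; apply/orP; right; rewrite leq_exp2r // addn1.
have qs : (q <= size s)%N by rewrite /q -mul2n.
have E3 : (2 * n <= 3 * (l * (q + t + 1)))%N.
  have := leq_trunc_div n.*2 3; lia.
have mu0 : 0 < mu by apply: lt_le_trans mu43; rewrite divr_gt0 ?ltr0n.
have E6 : mu ^+ 6 = m%:R by rewrite Emu root6X.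
have {}E3 : 2 * mu ^+ 12 <= 3 * (l%:R * (q%:R + t%:R + 1)).
  rewrite (exprM mu 6 2) E6 -natrX -/n.
  by move: E3; rewrite -(ler_nat R) !natrM !natrD.
have qR : q%:R <= 689%:R * mu ^+ 9 by apply: le_trans sz; rewrite ler_nat.
have tR : 2 * t%:R <= 3 * mu ^+ 6.
  by move: tm; rewrite -(ler_nat R) !natrM E6.
have mu9 : mu ^+ 9 = mu ^+ 3 * mu ^+ 6 by rewrite -exprD.
have mu12 : mu ^+ 12 = mu ^+ 3 * mu ^+ 9 by rewrite -exprD.
have m3 : 1000%:R <= mu ^+ 3.
  apply: (@le_trans _ _ ((432%:R / 10%:R) ^+ 3)); first by clear; lra.
  by rewrite lerXn2r // nnegrE ?divr_ge0 // ltW.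
have m6 : 1 <= mu ^+ 6 by rewrite E6 ler1n (leq_trans _ m200).
have sum : q%:R + t%:R + 1 <= 690%:R * mu ^+ 9.
  have : 1000%:R * mu ^+ 6 <= mu ^+ 9 by rewrite mu9 ler_wpM2r // (le_trans ler01).
  by move: qR tR m6; move: (mu ^+ 9) (mu ^+ 6) (q%:R : R) (t%:R : R) => u v w z; clear; lra.
have m9 : 0 < mu ^+ 9 by apply: exprn_gt0.
have : 1040%:R * (l%:R * (q%:R + t%:R + 1)) <= mu ^+ 3 * (690%:R * mu ^+ 9).
  have w0 : 0 <= q%:R + t%:R + 1 :> R by rewrite !addr_ge0.
  move: (q%:R + t%:R + 1 : R) sum w0 => w sum w0; rewrite mulrA; apply: (ler_pM _ w0 lle sum).
  by rewrite mulr_ge0.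
rewrite mu12 in E3; have : 0 < mu ^+ 3 * mu ^+ 9 by rewrite mulr_gt0 ?exprn_gt0.
rewrite [mu ^+ 3 * (_ * _)]mulrCA; move: E3.
by move: (mu ^+ 3 * mu ^+ 9) (l%:R * (q%:R + t%:R + 1)) => u v; clear; lra.
Qed.

Lemma exists_exceptional_prime (R : rcfType) (m : nat) : (652 * 10 ^ 7 <= m)%N ->
  exists p : nat, [/\ prime p, (m ^ 2 < p)%N, (p < 2 * m ^ 2)%N &
        ~ (exists x y z : nat,
             [/\ (0 < x)%N, (0 < y)%N, (0 < z)%N &
                 m%:R / p%:R = x%:R^-1 + y%:R^-1 + z%:R^-1 :> rat])].
Proof.
move=> hm; pose mu := root6 R m.
have hmR : 652%:R * 10%:R ^+ 7 <= m%:R :> R by rewrite -natrX -natrM ler_nat.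
have m200 : (200 <= m)%N.
  by rewrite -(ler_nat R); apply: le_trans hmR; clear; lra.
clear hm.
(* [43.2^6] is slightly below [6.5 * 10^9]. *)
have mu43 : 432%:R / 10%:R <= mu.
  apply: ler_sixth; rewrite ?root6_ge0 ?divr_ge0 // root6X.
  by apply: le_trans hmR; clear; lra.
have sz : (size (type1_values m ++ type2_values m))%:R <= 689%:R * mu ^+ 9.
  rewrite size_cat natrD.
  have := lerD (size_type1_values m200 erefl mu43) (size_type2_values m200 erefl mu43).
  by move: (_%:R + _%:R : R) (mu ^+ 9) => u v; clear; lra.
have [p [pp mp pm pN]] := exists_prime_notin m200 erefl mu43 sz.
exists p; split=> // -[x [y [z [x0 y0 z0 E]]]].
move: pN; rewrite mem_cat negb_or => /andP[/negP N1 /negP N2].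
have m3 : (3 < m)%N by apply: leq_trans m200.
have [[k [a [h [f [pos dv Ef le]]]]]|[k [a [g [e [pos Ee le]]]]]] :=
    unit_fraction_sum_cases pp m3 mp pm x0 y0 z0 E.
  by apply: N1; apply: mem_type1_values mp pm pos dv Ef le.
by apply: N2; apply: mem_type2_values pos Ee le.
Qed.

(* The bound 6.52 * 10^9 is written 652 * 10 ^ 7, which avoids a huge unary
   literal. *)
Theorem theorem1p2 (m : nat) (hm : (652 * 10 ^ 7 <= m)%N) :
  exists p : nat,
    [/\ prime p, (m ^ 2 < p)%N, (p < 2 * m ^ 2)%N &
        ~ (exists x y z : nat,
             [/\ (0 < x)%N, (0 < y)%N, (0 < z)%N &
                 m%:R / p%:R = x%:R^-1 + y%:R^-1 + z%:R^-1 :> rat])].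
Proof. exact: (exists_exceptional_prime {realclosure rat} hm). Qed.
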